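(* Let $\mathcal{D}_n=\{1,\dots,n\}^d$ be a $d$-dimensional cube with side-length $n\ge2$, and put $N=|\mathcal{D}_n|=n^d$. Consider a real-valued integrable random field $(X_t)_{t\in\mathbb{Z}^d}$ which satisfies the weak dependency Assumption WD$(p)$ for a given $p\in[2,+\infty]$, with constant $M_p$ and function $\varphi_p(\cdot)$, and let $S_{\mathcal{D}_n}=\sum_{t\in\mathcal{D}_n}(X_t-\mathbb{E}[X_t])$. Then: 1. If $p\in[2,+\infty)$ and $\varphi_p(r)\le cr^{-\alpha}$, $\alpha>0$, $c\ge1$, then $$\|N^{-1}S_{\mathcal{D}_n}\|_p\le c\,C_{d,\alpha}\sqrt{p}\,M_p\,N^{-\min(\frac12,\frac{\alpha}{d})}\quad\text{if }\alpha\ne d/2,$$ $$\|N^{-1}S_{\mathcal{D}_n}\|_p\le c\,\widetilde{C}_d\sqrt{p}\,M_p\,N^{-\frac12}(\log_2N)^{\frac d2+1}\quad\text{if }\alpha=d/2,$$ where $$C_{d,\alpha}:=24\cdot2^{d+\alpha}d^{2\alpha}\left|1-2^{\frac{\frac d2-\alpha}{1+\alpha}}\right|^{-(1+\alpha)}\qquad\text{and}\qquad\widetilde{C}_d:=15\cdot(8d)^{d/2}.$$ 2. If $p=\infty$ and $\varphi_\infty(r)\le cr^{-\alpha}$, $\alpha>0$, $c\ge1$, then, with the same $C_{d,\alpha}$ and $\widetilde{C}_d$, $$\|N^{-1}S_{\mathcal{D}_n}\|_{\mathrm{SG}}\le2.5\,c\,C_{d,\alpha}M_\infty N^{-\min(\frac12,\frac{\alpha}{d})}\quad\text{if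 }\alpha\ne d/2,$$ $$\|N^{-1}S_{\mathcal{D}_n}\|_{\mathrm{SG}}\le2.5\,c\,\widetilde{C}_dM_\infty N^{-\frac12}(\log_2N)^{\frac d2+1}\quad\text{if }\alpha=d/2.$$ 3. Furthermore, if $\varphi_p(r)\le c\exp(-\gamma r^\eta)$, with $c\ge1$, $\gamma>0$, $\eta>0$, then $$\|N^{-1}S_{\mathcal{D}_n}\|_p\le c\,M_p\,C_{\gamma,\eta,d}\,N^{-\frac12}\qquad\big(\text{respectively }\|N^{-1}S_{\mathcal{D}_n}\|_{\mathrm{SG}}\le c\,M_\infty\,C_{\gamma,\eta,d}\,N^{-\frac12}\text{ when }p=\infty\big)$$ for some factor $C_{\gamma,\eta,d}>0$ only depending on $\gamma,\eta,d$.
   Context: All random variables are defined on a probability space $(\Omega,\mathcal{F},\mathbb{P})$; $\|\cdot\|_p$ is the $L^p(\mathbb{P})$ norm; $|A|$ is the cardinality of a finite set $A$. Assumption WD$(p)$: for $t=(t_1,\dots,t_d)\in\mathbb{Z}^d$ and an integer $k>0$, let $\mathcal{M}_{t,k}$ be the $\sigma$-algebra generated by $\{X_u:u=(u_1,\dots,u_d)\in\mathbb{Z}^d,\ \sup_i(t_i-u_i)\ge k\}$. The field satisfies WD$(p)$ if $$\forall t\in\mathbb{Z}^d,\ \forall r>0:\quad\big\|\mathbb{E}[X_t\mid\mathcal{M}_{t,r}]-\mathbb{E}[X_t]\big\|_p\le M_p\,\varphi_p(r)$$ ($r$ ranging over the positive integers), where $\varphi_p(\cdot)$ is a non-increasing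 function such that $\varphi_p(0)=1$, and $M_p$ is a real constant. Sub-Gaussian norm: for a centered real random variable $Z$, $\|Z\|_{\mathrm{SG}}:=\inf\{c\ge0:\mathbb{E}[\exp(\lambda Z)]\le\exp(\lambda^2c^2/2)\text{ for all }\lambda\in\mathbb{R}\}$.
   Formalization: WD(p) is required also at r=0, i.e. ‖X_t−E[X_t]‖_p ≤ M_p (with r>0 only, i.i.d. fields satisfy it with M_p=0 and the bounds fail); in item 3 for p<∞ the factor is K·√p with K depending only on γ,η,d, since i.i.d. signs rule out a p-free factor. *)

(* Defs.v *)
From HB Require Import structures.
From mathcomp Require Import all_boot all_order all_algebra.
From mathcomp Require Import all_classical all_reals all_analysis.

Set Implicit Arguments.
Unset Strict Implicit.
Unset Printing Implicit Defensive.
Import Order.TTheory GRing.Theory Num.Theory.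
Import numFieldNormedType.Exports.
Local Open Scope classical_set_scope.
Local Open Scope ring_scope.

Section RandomFields.
Context {R : realType} {disp : measure_display} {T : measurableType disp}.
Variable P : probability T R.

(* Y is a version of the conditional expectation of X given the sigma-algebra
   G (a family of events, assumed to consist of measurable sets) *)
Definition is_cond_expectation (G : set (set T)) (X Y : T -> R) : Prop :=
  [/\ forall B : set R, measurable B -> G (Y @^-1` B),
      P.-integrable setT (EFin \o Y) &
      forall A, G A ->
        (\int[P]_(w in A) (Y w)%:E = \int[P]_(w in A) (X w)%:E)%E].

(* Infimum taken in \bar R, so that it is +oo when no constant is admissible *)
Definition sub_gaussian_norm (Z : T -> R) : \bar R :=
  ereal_inf [set c%:E | c in [set c : R | 0 <= c /\
    forall l : R,
      ('E_P[fun w => expR (l * Z w)] <= (expR (l ^+ 2 * c ^+ 2 / 2))%:E)%E]].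

Definition mean (Z : T -> R) : R := fine 'E_P[Z].

Variables (d : nat) (X : 'rV[int]_d -> {RV P >-> R}).

(* For d > 0, sup_i (t_i - u_i) >= k is the existence of an i with
   t_i - u_i >= k. *)
Definition past_sigma (t : 'rV[int]_d) (k : nat) : set (set T) :=
  <<s \bigcup_(u in [set u : 'rV[int]_d | exists i, k%:Z <= t 0 i - u 0 i])
        preimage_set_system setT (X u) measurable >>.

(* The index r = 0 is included. Since X_t is measurable for past_sigma t 0 and
   phi 0 = 1, it says that `X_t - E X_t` has p-norm at most M, which is what
   the normalization phi 0 = 1 stands for. Were r restricted to r > 0, every
   independent field would satisfy the condition with M = 0 (or any M >= 0),
   and no bound of the centered sums in terms of M could hold. *)
Definition WD (p : \bar R) (M : R) (phi : nat -> R) : Prop :=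
  [/\ forall r s : nat, (r <= s)%N -> phi s <= phi r,
      phi 0%N = 1 &
      forall (t : 'rV[int]_d) (r : nat), exists Y : T -> R,
        is_cond_expectation (past_sigma t r) (X t) Y /\
        ('N[P]_p [ (fun w => (Y w - mean (X t))%:E) ] <= (M * phi r)%:E)%E].

Definition integrable_field : Prop :=
  forall t, P.-integrable setT (EFin \o X t).

(* The points of {1, ..., n}^d are the k + (1, ..., 1) with k in
   {0, ..., n - 1}^d. *)
Definition cube_sum (n : nat) (w : T) : R :=
  \sum_(k : {ffun 'I_d -> 'I_n})
     let t : 'rV[int]_d := \row_i (k i).+1%:Z in X t w - mean (X t).

Definition cube_average (n : nat) (w : T) : R :=
  ((n ^ d)%N%:R)^-1 * cube_sum n w.

End RandomFields.

Definition log2 {R : realType} (x : R) : R := ln x / ln 2.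

Definition C_poly {R : realType} (d : nat) (alpha : R) : R :=
  24 * 2 `^ (d%:R + alpha) * d%:R `^ (2 * alpha) *
  `|1 - 2 `^ ((d%:R / 2 - alpha) / (1 + alpha))| `^ (- (1 + alpha)).

Definition C_crit {R : realType} (d : nat) : R :=
  15 * (8 * d%:R) `^ (d%:R / 2).

(* Main.v *)
Require Import Defs.
From HB Require Import structures.
From mathcomp Require Import all_boot all_order all_algebra.
From mathcomp Require Import all_classical all_reals all_analysis.
From mathcomp Require Import measurable_realfun ess_sup_inf.
From mathcomp Require Import ring lra zify.
Import Order.TTheory GRing.Theory Num.Theory.
Import numFieldNormedType.Exports.
Set Implicit Arguments.
Unset Strict Implicit.
Unset Printing Implicit Defensive.
Local Open Scope classical_set_scope.
Local Open Scope ring_scope.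

(* Let the cube average be approximated by functions of finitely many
   threshold indicators of the [X_t], so that conditional expectations become
   finite sums; Fatou's lemma removes this discretization in the end.

   On each axis keep only the points of a Cantor-like set: 2^k points per period,
   with a gap before every multiple of 2^j that grows with j.  In a product of
   such sets, order the dyadic blocks hierarchically, coarsest level first.  Any
   point in an earlier level-j block then precedes a given point t, in some
   coordinate, by at least the level-j gap, hence belongs to the past of t at
   that distance.  Telescoping the conditional expectation of X_t over the
   levels j writes the sum over the product set as one martingale per level,
   whose steps are the sums over the level-j blocks, of at most 2^(jd) points,
   and are controlled by phi(gap j).  Martingales are bounded by the 2-uniform
   smoothness |x+y|^2 + |x-y|^2 <= 2 |x|^2 + 2(p-1) |y|^2 of L^p, or by Azuma's
   inequality when p is infinite.

   Averaging over all translates of the product set covers the cube uniformly.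
   Gaps that fill a proportion 1/(2d) of a period cost only a bounded factor, and
   splitting this proportion geometrically between the levels gives the
   constants.  Exponential decay is dominated by polynomial decay of order
   alpha = d. *)

(** * Two-point inequalities *)

(** In the full cube, points of adjacent blocks can be neighbours: earlier blocks then come within
    distance one of a point, and [phi] of that distance gives no gain. Hence points are discarded
    near block boundaries at every scale, and recovered by translation. After summation over its
    blocks, level j costs about sqrt (2^(jd) N) phi (gap j). With gap j of order 2^j and polynomial
    decay this is sqrt N times 2^(j (d/2 - alpha)), so the sign of d/2 - alpha separates three
    regimes: the fine levels dominate and give the rate N^(-1/2), the coarse ones dominate and give
    N^(-alpha/d), or all of them weigh the same and a logarithm appears. In the last case the k + 1
    levels share the available gap equally; each gap shrinks by the factor k + 1, which costs (k +
    1)^(d/2) on top of the k + 1 terms, whence the exponent d/2 + 1. *)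

Lemma is_derive_ge0_le (R : realType) (f f' : R -> R) (z : R) : 0 <= z ->
  (forall x, 0 <= x <= z -> is_derive x 1 f (f' x)) ->
  (forall x, 0 <= x <= z -> 0 <= f' x) -> f 0 <= f z.
Proof.
move=> z0 df f'0; apply: (@ger0_derive1_ndecr R f 0 z) => //.
- move=> x; rewrite in_itv /= => /andP[x0 xz].
  by have [] := df x; rewrite ?(ltW x0) ?(ltW xz).
- move=> x; rewrite in_itv /= => /andP[x0 xz].
  have xz' : 0 <= x <= z by rewrite (ltW x0) (ltW xz).
  by rewrite derive1E; have [_ ->] := df x xz'; exact: f'0.
- apply: derivable_within_continuous => x; rewrite in_itv /= => xz.
  by have [] := df x xz.
Qed.

(** With k = p - 1 this is the sign of the derivative in [two_point_lt1]. The difference of the two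
    sides vanishes at 0, and its derivative [f'] is nonnegative because k - 1 >= 0. *)
Lemma two_point_aux (R : realType) (k z : R) : 1 <= k -> 0 <= z < 1 ->
  (1 + z) `^ k * (1 - k * z) <= (1 - z) `^ k * (1 + k * z).
Proof.
move=> k1 /andP[z0 z1].
pose f x : R := (1 - x) `^ k * (1 + k * x) - (1 + x) `^ k * (1 - k * x).
pose f' x : R := k * (k + 1) * x * ((1 + x) `^ (k - 1) - (1 - x) `^ (k - 1)).
suff : f 0 <= f z.
  by rewrite /f mulr0 !subr0 !addr0 powR1 subrr subr_ge0.
apply: (@is_derive_ge0_le R f f') => // x /andP[x0 xz].
- have x1 : 0 < 1 - x by lra.
  have x2 : 0 < 1 + x by lra.
  have d1 : is_derive x 1 (fun y : R => (1 - y) `^ k) (- (k * (1 - x) `^ (k - 1))).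
    have := @is_derive1_comp R (fun y => y `^ k) (fun y => 1 - y) x _ (-1) (is_derive1_powR k x1).
    rewrite mulrN1; apply.
    by apply: is_derive_eq; rewrite ?add0r ?mul1r ?addr0 ?mulr1.
  have d2 : is_derive x 1 (fun y : R => (1 + y) `^ k) (k * (1 + x) `^ (k - 1)).
    have := @is_derive1_comp R (fun y => y `^ k) (fun y => 1 + y) x _ 1 (is_derive1_powR k x2).
    rewrite mulr1; apply.
    by apply: is_derive_eq; rewrite ?add0r ?mul1r ?addr0 ?mulr1.
  apply: is_derive_eq.
  rewrite /f' -(@mulr_powRB1 _ (1 - x) k); [|lra|lra].
  rewrite -(@mulr_powRB1 _ (1 + x) k); [|lra|lra].
  rewrite /GRing.scale /=; ring.
- rewrite /f' mulr_ge0 //; first by rewrite mulr_ge0 // mulr_ge0; lra.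
  rewrite subr_ge0 ge0_ler_powR ?nnegrE; lra.
Qed.

(** The function [f], the logarithm of the ratio of the two sides up to ln 2, is nondecreasing. The
    endpoint z = 1 is left out since real powers of 1 - x are differentiated. *)
Lemma two_point_lt1 (R : realType) (p z : R) : 2 <= p -> 0 <= z < 1 ->
  ((1 + z) `^ p + (1 - z) `^ p) / 2 <= (1 + (p - 1) * z ^+ 2) `^ (p / 2).
Proof.
move=> p2 /andP[z0 z1].
pose u x : R := (1 + x) `^ p + (1 - x) `^ p.
pose v x : R := 1 + (p - 1) * (x * x).
have u_gt0 x : 0 <= x < 1 -> 0 < u x.
  by move=> /andP[x0 x1]; rewrite /u addr_gt0 // powR_gt0; lra.
have v_gt0 x : 0 < v x by rewrite /v; nra.
pose f x : R := p / 2 * ln (v x) - ln (u x).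
pose f' x : R := p / 2 * ((p - 1) * (2 * x) / v x) -
   p * ((1 + x) `^ (p - 1) - (1 - x) `^ (p - 1)) / u x.
have : f 0 <= f z.
  apply: (@is_derive_ge0_le R f f' z z0) => x /andP[x0 xz].
  - have x1 : 0 < 1 - x by lra.
    have x2 : 0 < 1 + x by lra.
    have d1 : is_derive x 1 (fun y : R => (1 - y) `^ p) (- (p * (1 - x) `^ (p - 1))).
      have := @is_derive1_comp R (fun y => y `^ p) (fun y => 1 - y) x _ (-1) (is_derive1_powR p x1).
      rewrite mulrN1; apply.
      by apply: is_derive_eq; rewrite ?add0r ?mul1r ?addr0 ?mulr1.
    have d2 : is_derive x 1 (fun y : R => (1 + y) `^ p) (p * (1 + x) `^ (p - 1)).
      have := @is_derive1_comp R (fun y => y `^ p) (fun y => 1 + y) x _ 1 (is_derive1_powR p x2).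
      rewrite mulr1; apply.
      by apply: is_derive_eq; rewrite ?add0r ?mul1r ?addr0 ?mulr1.
    have du : is_derive x 1 u (p * ((1 + x) `^ (p - 1) - (1 - x) `^ (p - 1))).
      by apply: is_derive_eq; ring.
    have dv : is_derive x 1 v ((p - 1) * (2 * x)).
      by apply: is_derive_eq; rewrite /GRing.scale /=; ring.
    have ux : 0 < u x by rewrite u_gt0 ?x0 ?(le_lt_trans xz).
    have := @is_derive1_comp R _ u x _ _ (is_derive1_ln ux) du.
    have := @is_derive1_comp R _ v x _ _ (is_derive1_ln (v_gt0 x)) dv.
    move=> dlv dlu.
    apply: is_derive_eq.
    by rewrite /f' /GRing.scale /=; ring.
  - have ux : 0 < u x by rewrite u_gt0 ?x0 ?(le_lt_trans xz).
    rewrite /f' subr_ge0 ler_pdivrMr //.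
    rewrite [X in _ <= X](_ : _ = p * ((p - 1) * x * u x) / v x); last first.
      by field; rewrite gt_eqF.
    rewrite ler_pdivlMr // -[X in X <= _]mulrA ler_pM2l; last lra.
    have aux : (1 + x) `^ (p - 1) * (1 - (p - 1) * x) <=
               (1 - x) `^ (p - 1) * (1 + (p - 1) * x).
      by apply: two_point_aux; [lra|rewrite x0 (le_lt_trans xz)].
    rewrite /u /v -(@mulr_powRB1 _ (1 - x) p); [|lra|lra].
    rewrite -(@mulr_powRB1 _ (1 + x) p); [|lra|lra].
    lra.
rewrite /f /v /u mul0r mulr0 addr0 subr0 powR1 ln1 mulr0 sub0r.
have uz : 0 < u z by rewrite u_gt0 ?z0.
have e0 : 1 + 1 = 2 :> R by [].
rewrite e0 -/(u z) -/(v z) -ln_powR => ineq.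
have : ln (u z / 2) <= ln (v z `^ (p / 2)).
  by rewrite lnM ?posrE ?invr_gt0 // lnV ?posrE //; lra.
rewrite ler_ln ?posrE ?powR_gt0 ?divr_gt0 //.
Qed.

(* Scalar case of the 2-uniform smoothness of L^p, with its sharp constant. *)
Lemma two_point (R : realType) (p a b : R) : 2 <= p ->
  (`|a + b| `^ p + `|a - b| `^ p) / 2 <=
  (a ^+ 2 + (p - 1) * b ^+ 2) `^ (p / 2).
Proof.
move=> p2.
have p0 : p != 0 by rewrite gt_eqF //; lra.
(* The endpoint z = 1: it follows from ln (p/2) >= 1 - 2/p and ln 2 <= 1. *)
have twop : 2 `^ p / 2 <= p `^ (p / 2).
  have lnp : 1 - (p / 2)^-1 <= ln (p / 2).
    have w0 : 0 < (p / 2)^-1 by rewrite invr_gt0; lra.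
    have := @le_ln1Dx R ((p / 2)^-1 - 1).
    have -> : 1 + ((p / 2)^-1 - 1) = (p / 2)^-1 by ring.
    rewrite lnV ?posrE; last lra.
    by move=> h; have := h ltac:(lra); lra.
  have ln2 : ln 2 <= 1 :> R by have := @le_ln1Dx R 1; apply; lra.
  rewrite -ler_ln ?posrE ?divr_gt0 ?powR_gt0 //; last lra.
  rewrite lnM ?posrE ?invr_gt0 ?powR_gt0 // lnV ?posrE // !ln_powR.
  have -> : ln p = ln 2 + ln (p / 2).
    by rewrite -lnM ?posrE ?divr_gt0 //; [congr ln; field|lra].
  have : p / 2 * (1 - (p / 2)^-1) <= p / 2 * ln (p / 2) by rewrite ler_wpM2l //; lra.
  have -> : p / 2 * (1 - (p / 2)^-1) = p / 2 - 1 by field.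
  nra.
have unit (z : R) : 0 <= z <= 1 ->
    ((1 + z) `^ p + (1 - z) `^ p) / 2 <= (1 + (p - 1) * z ^+ 2) `^ (p / 2).
  case/andP => z0; rewrite le_eqVlt => /predU1P[->|z1]; last first.
    by apply: two_point_lt1; rewrite ?z0.
  rewrite subrr powR0 // addr0 expr1n mulr1.
  by have -> : 1 + (p - 1) = p by ring.
have pos (x y : R) : 0 <= y <= x ->
    (`|x + y| `^ p + `|x - y| `^ p) / 2 <=
    (x ^+ 2 + (p - 1) * y ^+ 2) `^ (p / 2).
  case/andP => y0 yx.
  have [x0|x0] := leP x 0.
    have -> : x = 0 by lra.
    have -> : y = 0 by lra.
    by rewrite subrr addr0 normr0 powR0 // addr0 mul0r powR_ge0.
  have /unit : 0 <= y / x <= 1 by rewrite divr_ge0 ?(ltW x0) //= ler_pdivrMr ?mul1r.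
  move/(ler_wpM2l (powR_ge0 x p)).
  have -> : x `^ p * (1 + (p - 1) * (y / x) ^+ 2) `^ (p / 2) =
            (x ^+ 2 + (p - 1) * y ^+ 2) `^ (p / 2).
    have {1}-> : p = 2 * (p / 2) by field.
    rewrite powRrM powR_mulrn ?(ltW x0) // -powRM ?exprn_ge0 ?(ltW x0) //.
    - by congr (_ `^ _); field; rewrite gt_eqF.
    - by nra.
  apply: le_trans; rewrite mulrA ler_wpM2r ?invr_ge0 // mulrDr.
  have yx1 : y / x <= 1 by rewrite ler_pdivrMr ?mul1r.
  have yx0 : 0 <= y / x by rewrite divr_ge0 ?(ltW x0).
  rewrite -!powRM ?(ltW x0) //; [|lra|lra].
  rewrite !mulrDr mulrN mulr1 mulrCA divff ?gt_eqF // mulr1 !ger0_norm //; lra.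
have sq (x y : R) : (`|x + y| `^ p + `|x - y| `^ p) =
    `| `|x| + `|y| | `^ p + `| `|x| - `|y| | `^ p.
  case: (ger0P x) => x0; case: (ger0P y) => y0 //.
  - by rewrite opprK addrC.
  - rewrite -(normrN (x + y)) -(normrN (x - y)).
    have -> : - (x + y) = - x - y by ring.
    have -> : - (x - y) = - x + y by ring.
    exact: addrC.
  - rewrite -(normrN (x + y)) -(normrN (x - y)).
    have -> : - (x + y) = - x + - y by ring.
    by have -> : - (x - y) = - x - - y by ring.
rewrite sq -(real_normK (num_real a)) -(real_normK (num_real b)).
have [ba|ab] := leP `|b| `|a|; first by apply: pos; rewrite normr_ge0.
(* The left side is symmetric in |a| and |b|; exchanging them when |a| < |b| gives an even smaller
   right side, as p - 1 >= 1. *)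
rewrite (_ : _ + _ = `| `|b| + `|a| | `^ p + `| `|b| - `|a| | `^ p); last by rewrite (addrC `|a|) distrC.
apply: le_trans (pos _ _ _) _; first by rewrite normr_ge0 ltW.
have := normr_ge0 a => a0.
have ab2 : `|a| ^+ 2 <= `|b| ^+ 2 by rewrite ler_pXn2r ?nnegrE // ltW.
apply: ge0_ler_powR; rewrite ?nnegrE; [lra| | |].
- by rewrite addr_ge0 ?mulr_ge0 ?sqr_ge0 //; lra.
- by rewrite addr_ge0 ?mulr_ge0 ?sqr_ge0 //; lra.
- nra.
Qed.

(** The derivative of exp (-x^2/2) cosh x has the sign of sinh x - x cosh x, which [aux] shows to be
    nonpositive for x >= 0. *)
Lemma cosh_le (R : realType) (t : R) :
  (expR t + expR (- t)) / 2 <= expR (t ^+ 2 / 2).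
Proof.
wlog t0 : t / 0 <= t.
  move=> h; have [/h//|t0] := leP 0 t.
  have := h (- t); rewrite opprK sqrrN addrC; apply; lra.
have aux (x : R) : 0 <= x -> (1 - x) * expR x <= (1 + x) * expR (- x).
  move=> x0; pose f x : R := (1 + x) * expR (- x) - (1 - x) * expR x.
  pose f' x : R := x * (expR x - expR (- x)).
  suff : f 0 <= f x by rewrite /f oppr0 expR0; lra.
  apply: (@is_derive_ge0_le R f f') => // y /andP[y0 yx].
  - by apply: is_derive_eq; rewrite /f' /GRing.scale /=; ring.
  - by rewrite /f' mulr_ge0 // subr_ge0 ler_expR; lra.
pose f x : R := 2 - (expR (x - x * x / 2) + expR (- x - x * x / 2)).
pose f' x : R := (1 + x) * expR (- x - x * x / 2) - (1 - x) * expR (x - x * x / 2).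
have : f 0 <= f t.
  apply: (@is_derive_ge0_le R f f') => // y /andP[y0 yx].
  - by apply: is_derive_eq; rewrite /f' /GRing.scale /=; field.
  - rewrite /f' subr_ge0 !expRD !mulrA ler_wpM2r ?expR_ge0 //; exact: aux.
rewrite /f !mul0r subrr oppr0 addr0 expR0 !expRD !expRN -mulrDl => h.
rewrite expr2; have e0 := expR_gt0 (t * t / 2).
have : (expR t + (expR t)^-1) / expR (t * t / 2) <= 2 by lra.
by rewrite ler_pdivrMr //; lra.
Qed.

Lemma powR_conv (R : realType) (p s t x y : R) : 1 <= p -> 0 <= s -> 0 <= t ->
  s + t = 1 -> 0 <= x -> 0 <= y ->
  (s * x + t * y) `^ p <= s * x `^ p + t * y `^ p.
Proof.
move=> p1 s0 t0 st x0 y0.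
have s1 : s <= 1 by lra.
have := convex_powR p1 (Itv01 s0 s1) (x := x) (y := y).
rewrite !inE /= !in_itv /= !andbT => /(_ x0 y0).
rewrite !convRE /=.
by have <- : 1 - s = t by lra.
Qed.

Lemma expR_conv (R : realType) (s t x y : R) : 0 <= s -> 0 <= t -> s + t = 1 ->
  expR (s * x + t * y) <= s * expR x + t * expR y.
Proof.
move=> s0 t0 st; have s1 : s <= 1 by lra.
have := convex_expR (Itv01 s0 s1) x y.
rewrite !convRE /=.
by have <- : 1 - s = t by lra.
Qed.

(** Supporting line of |.|^p at [a], obtained from Young's inequality with exponents p/(p-1) and p.
    It yields both the orthogonality argument and Jensen's inequality below. *)
Lemma powR_tangent (R : realType) (p a c : R) : 1 < p ->
  `|a| `^ p + p * `|a| `^ (p - 2) * a * (c - a) <= `|c| `^ p.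
Proof.
move=> p1; have p0 : 0 < p by lra.
have [->|a0] := eqVneq a 0.
  by rewrite normr0 mulr0 mul0r addr0 powR0 ?gt_eqF // powR_ge0.
have na : 0 < `|a| by rewrite normr_gt0.
have eA : `|a| `^ (p - 2) * a * a = `|a| `^ p.
  rewrite -mulrA -expr2 -(real_normK (num_real a)) -powR_mulrn ?normr_ge0 //.
  by rewrite -powRD ?(gt_eqF na) ?implybT // subrK.
have eB : `|a| `^ (p - 2) * `|a| = `|a| `^ (p - 1).
  rewrite -[X in _ * X]powRr1 ?normr_ge0 // -powRD ?(gt_eqF na) ?implybT //.
  by congr (_ `^ _); ring.
have h1 : `|a| `^ (p - 2) * a * c <= `|a| `^ (p - 1) * `|c|.
  rewrite -eB -!mulrA ler_wpM2l ?powR_ge0 // -normrM; exact: ler_norm.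
have := @conjugate_powR R (`|a| `^ (p - 1)) `|c| (p / (p - 1)) p (powR_ge0 _ _)
  (normr_ge0 _).
have -> : (`|a| `^ (p - 1)) `^ (p / (p - 1)) = `|a| `^ p.
  by rewrite -powRrM; congr (_ `^ _); field; lra.
move=> h; have {h} := h ltac:(by rewrite divr_gt0; lra) p0
  ltac:(by field; apply/andP; split; lra).
move/(ler_wpM2l (ltW p0)).
have -> : p * (`|a| `^ p / (p / (p - 1)) + `|c| `^ p / p) =
   (p - 1) * `|a| `^ p + `|c| `^ p by field; apply/andP; split; lra.
have := ler_wpM2l (ltW p0) h1.
have -> : p * `|a| `^ (p - 2) * a * (c - a) =
  p * (`|a| `^ (p - 2) * a * c) - p * (`|a| `^ (p - 2) * a * a) by ring.
rewrite eA; lra.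
Qed.

Lemma powR_le_inv (R : realType) (r x y : R) : 0 < r -> 0 <= x -> 0 <= y ->
  x `^ r <= y `^ r -> x <= y.
Proof.
move=> r0 x0 y0; apply: contraTT; rewrite -!ltNge => yx.
by apply: gt0_ltr_powR; rewrite ?nnegrE.
Qed.

Lemma sqr_powR_half (R : realType) (p x : R) : 0 <= x -> (x ^+ 2) `^ (p / 2) = x `^ p.
Proof.
move=> x0; rewrite -powR_mulrn // -powRrM; congr (_ `^ _); by field.
Qed.

(** Passes from p-th powers, where the two-point inequality holds, to squares: the quadratic mean is
    at most the p-mean. *)
Lemma power_mean2 (R : realType) (p A B C : R) : 2 <= p -> 0 <= A -> 0 <= B ->
  0 <= C -> 2^-1 * A `^ p + 2^-1 * B `^ p <= C `^ (p / 2) ->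
  A ^+ 2 + B ^+ 2 <= 2 * C.
Proof.
move=> p2 A0 B0 C0 h.
have r0 : 0 < p / 2 by lra.
have r1 : 1 <= p / 2 by lra.
have h2 : 0 <= 2^-1 :> R by rewrite invr_ge0.
have h12 : 2^-1 + 2^-1 = 1 :> R by field.
rewrite mulrC -ler_pdivrMr // mulrC mulrDr.
apply: (powR_le_inv r0) => //.
  by apply: addr_ge0; apply: mulr_ge0 => //; exact: sqr_ge0.
apply: le_trans (powR_conv r1 h2 h2 h12 (sqr_ge0 _) (sqr_ge0 _)) _.
by rewrite (sqr_powR_half _ A0) (sqr_powR_half _ B0).
Qed.

(** * Martingale steps on a finite probability space *)

Section WeightedNorms.
Context {R : realType} {Om : finType}.
Variable w : Om -> R.
Hypothesis w_ge0 : forall o, 0 <= w o.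
Hypothesis w_sum1 : \sum_o w o = 1.

Definition wmean (f : Om -> R) : R := \sum_o w o * f o.

Lemma wmean_le f g : (forall o, f o <= g o) -> wmean f <= wmean g.
Proof. by move=> fg; apply: ler_sum => o _; rewrite ler_wpM2l. Qed.

Lemma wmean_ge0 f : (forall o, 0 <= f o) -> 0 <= wmean f.
Proof. by move=> f0; apply: sumr_ge0 => o _; rewrite mulr_ge0. Qed.

Lemma wmeanD f g : wmean (fun o => f o + g o) = wmean f + wmean g.
Proof. by rewrite -big_split; apply: eq_bigr => o _; rewrite mulrDr. Qed.

Lemma wmeanZ c f : wmean (fun o => c * f o) = c * wmean f.
Proof. by rewrite mulr_sumr; apply: eq_bigr => o _; rewrite mulrCA. Qed.

Lemma wmean_cst c : wmean (fun=> c) = c.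
Proof. by rewrite /wmean -mulr_suml w_sum1 mul1r. Qed.

Lemma eq_wmean f g : f =1 g -> wmean f = wmean g.
Proof. by move=> fg; apply: eq_bigr => o _; rewrite fg. Qed.

Lemma eq_wmean_supp f g : (forall o, w o * f o = w o * g o) -> wmean f = wmean g.
Proof. by move=> fg; apply: eq_bigr => o _. Qed.

(** Weights may vanish, so functions are controlled on the support only; the degenerate cases of the
    norm inequalities rest on this. *)
Lemma wmean_le0 f : (forall o, 0 <= f o) -> wmean f <= 0 ->
  forall o, w o = 0 \/ f o = 0.
Proof.
move=> f0 le0 o.
have s0 : \sum_o w o * f o = 0.
  by apply: le_anti; apply/andP; split => //; apply: sumr_ge0 => o' _; rewrite mulr_ge0.
have /eqP := psumr_eq0P (P := predT) (fun i _ => mulr_ge0 (w_ge0 i) (f0 i)) s0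
  (i := o) isT.
by rewrite mulf_eq0 => /orP[/eqP|/eqP]; [left|right].
Qed.

Lemma wmean_powR_eq0 r f : wmean (fun o => f o `^ r) <= 0 ->
  forall o, w o = 0 \/ f o = 0.
Proof.
move=> /wmean_le0 h o; have [] := h (fun o => powR_ge0 _ _) o; first by left.
by move=> /powR_eq0_eq0; right.
Qed.

Lemma wmean_le_supp f g : (forall o, 0 < w o -> f o <= g o) -> wmean f <= wmean g.
Proof.
move=> fg; apply: ler_sum => o _.
have [w0|w0] := ltP 0 (w o); first by rewrite ler_wpM2l // fg.
have -> : w o = 0 by apply: le_anti; rewrite w0 w_ge0.
by rewrite !mul0r.
Qed.

Local Opaque wmean.

(** Convexity of x^r at f/a and g/b, with weights a/(a+b) and b/(a+b). A zero bound forbids the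
    division, but makes the function vanish on the support. *)
Lemma wmean_minkowski r f g a b : 1 <= r -> 0 <= a -> 0 <= b ->
  (forall o, 0 <= f o) -> (forall o, 0 <= g o) ->
  wmean (fun o => f o `^ r) <= a `^ r -> wmean (fun o => g o `^ r) <= b `^ r ->
  wmean (fun o => (f o + g o) `^ r) <= (a + b) `^ r.
Proof.
move=> r1 a0 b0 f0 g0 fa gb; have r0 : 0 < r by lra.
have [a_eq0|aN0] := eqVneq a 0.
  have f_eq0 : forall o, w o = 0 \/ f o = 0.
    by apply: (wmean_powR_eq0 (r := r)) => //; rewrite (le_trans fa) // a_eq0 powR0 ?gt_eqF.
  rewrite a_eq0 add0r (le_trans _ gb) // le_eqVlt; apply/orP; left; apply/eqP.
  by apply: eq_wmean_supp => o; have [->|->] := f_eq0 o; rewrite ?mul0r ?add0r.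
have [b_eq0|bN0] := eqVneq b 0.
  have g_eq0 : forall o, w o = 0 \/ g o = 0.
    by apply: (wmean_powR_eq0 (r := r)) => //; rewrite (le_trans gb) // b_eq0 powR0 ?gt_eqF.
  rewrite b_eq0 addr0 (le_trans _ fa) // le_eqVlt; apply/orP; left; apply/eqP.
  by apply: eq_wmean_supp => o; have [->|->] := g_eq0 o; rewrite ?mul0r ?addr0.
have {a0 aN0} a0 : 0 < a by rewrite lt_neqAle eq_sym aN0.
have {b0 bN0} b0 : 0 < b by rewrite lt_neqAle eq_sym bN0.
have ab0 : 0 < a + b by rewrite addr_gt0.
pose s := a / (a + b); pose t := b / (a + b).
have s0 : 0 <= s by rewrite divr_ge0 // ltW.
have t0 : 0 <= t by rewrite divr_ge0 // ltW.
have st : s + t = 1 by rewrite -mulrDl divff // gt_eqF.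
have pt o : (f o + g o) `^ r <=
    (a + b) `^ r * (s * (a `^ r)^-1) * f o `^ r +
    (a + b) `^ r * (t * (b `^ r)^-1) * g o `^ r.
  have -> : f o + g o = (a + b) * (s * (f o / a) + t * (g o / b)).
    by rewrite /s /t; field; rewrite !gt_eqF.
  have fa0 : 0 <= f o / a by rewrite divr_ge0 // ltW.
  have gb0 : 0 <= g o / b by rewrite divr_ge0 // ltW.
  rewrite powRM; [|exact: ltW|by rewrite addr_ge0 // mulr_ge0].
  apply: le_trans (ler_wpM2l (powR_ge0 _ _) (powR_conv r1 s0 t0 st fa0 gb0)) _.
  rewrite !powRM ?f0 ?g0 ?invr_ge0 ?(ltW a0) ?(ltW b0) //.
  rewrite -(powR_inv1 (ltW a0)) -(powR_inv1 (ltW b0)) -!powRrM !mulN1r !powRN.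
  by rewrite le_eqVlt; apply/orP; left; apply/eqP; ring.
clearbody s t; apply: le_trans (wmean_le pt) _.
rewrite wmeanD !wmeanZ.
have ar : 0 < a `^ r by rewrite powR_gt0.
have br : 0 < b `^ r by rewrite powR_gt0.
rewrite -[X in _ <= X]mulr1 -st mulrDr -!mulrA.
by apply: lerD; apply: (ler_wpM2l (powR_ge0 _ _)); apply: ler_piMr => //;
  rewrite ler_pdivrMl // mulr1.
Qed.

Definition Lp_le (p : R) (f : Om -> R) (a : R) : Prop :=
  0 <= a /\ wmean (fun o => `|f o| `^ p) <= a `^ p.

(* The norm is kept abstract: unifying real powers by unfolding is very slow. *)
Lemma wnorm_def : {N : R -> (Om -> R) -> R |
  N = fun p f => wmean (fun o => `|f o| `^ p) `^ p^-1}.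
Proof. by exists (fun p f => wmean (fun o => `|f o| `^ p) `^ p^-1). Qed.

Definition wnorm : R -> (Om -> R) -> R := sval wnorm_def.

Lemma wnormE p f : wnorm p f = wmean (fun o => `|f o| `^ p) `^ p^-1.
Proof. by rewrite /wnorm (svalP wnorm_def). Qed.

Lemma wnorm_ge0 p f : 0 <= wnorm p f.
Proof. by rewrite wnormE powR_ge0. Qed.

Lemma wnorm_powR p f : 0 < p -> wnorm p f `^ p = wmean (fun o => `|f o| `^ p).
Proof.
move=> p0; rewrite wnormE -powRrM mulVf ?gt_eqF // powRr1 // wmean_ge0 //.
Qed.

Lemma wnormZ p c f : 0 < p -> wnorm p (fun o => c * f o) = `|c| * wnorm p f.
Proof.
move=> p0; rewrite !wnormE; under eq_wmean => o do rewrite normrM powRM ?normr_ge0 //.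
rewrite wmeanZ powRM ?powR_ge0 ?wmean_ge0 //.
by rewrite -powRrM divff ?gt_eqF // powRr1.
Qed.

Lemma Lp_leP p f a : 0 < p -> Lp_le p f a <-> wnorm p f <= a.
Proof.
move=> p0; split => [[a0]|fa].
  by rewrite -wnorm_powR // => /(powR_le_inv p0); apply; rewrite // wnorm_ge0.
have a0 : 0 <= a := le_trans (wnorm_ge0 p f) fa.
by split => //; rewrite -wnorm_powR // ge0_ler_powR ?nnegrE ?wnorm_ge0 // ltW.
Qed.

Lemma Lp_leD p f g a b : 1 <= p -> Lp_le p f a -> Lp_le p g b ->
  Lp_le p (fun o => f o + g o) (a + b).
Proof.
move=> p1 [a0 fa] [b0 gb]; split; first exact: addr_ge0.
apply: le_trans (wmean_minkowski p1 a0 b0 _ _ fa gb) => //.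
apply: wmean_le => o; apply: ge0_ler_powR; rewrite ?nnegrE ?addr_ge0 ?ler_normD //.
lra.
Qed.

Lemma Lp_leZ p f a c : 0 < p -> Lp_le p f a -> Lp_le p (fun o => c * f o) (`|c| * a).
Proof.
move=> p0 [a0 fa]; split; first exact: mulr_ge0.
under eq_wmean => o do rewrite normrM powRM ?normr_ge0 //.
by rewrite wmeanZ powRM // ler_wpM2l // powR_ge0.
Qed.

Lemma Lp_le_trans p f a b : 0 < p -> Lp_le p f a -> a <= b -> Lp_le p f b.
Proof. by move=> p0 /Lp_leP-/(_ p0) fa ab; apply/Lp_leP => //; exact: le_trans ab. Qed.

(** The two-point inequality at each point, then Minkowski's inequality in L^(p/2) for f^2 and (p-1)
    g^2. *)
Lemma wnorm_smooth p f g F G : 2 <= p ->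
  (forall o, F o = f o + g o) -> (forall o, G o = f o - g o) ->
  wnorm p F ^+ 2 + wnorm p G ^+ 2 <=
  2 * (wnorm p f ^+ 2 + (p - 1) * wnorm p g ^+ 2).
Proof.
move=> p2 eF eG; have p0 : 0 < p by lra.
have r1 : 1 <= p / 2 by lra.
have p1 : 0 <= p - 1 by lra.
have g0 : 0 <= (p - 1) * wnorm p g ^+ 2 := mulr_ge0 p1 (sqr_ge0 _).
apply: (power_mean2 p2 (wnorm_ge0 _ _) (wnorm_ge0 _ _)
  (addr_ge0 (sqr_ge0 _) g0)).
apply: (@le_trans _ _ (wmean (fun o =>
    2^-1 * `|F o| `^ p + 2^-1 * `|G o| `^ p))).
  by rewrite wmeanD !wmeanZ (wnorm_powR F p0) (wnorm_powR G p0).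
apply: (@le_trans _ _ (wmean (fun o => (f o ^+ 2 + (p - 1) * g o ^+ 2) `^ (p / 2)))).
  apply: wmean_le => o; apply: le_trans (two_point (f o) (g o) p2).
  by rewrite eF eG -mulrDr mulrC.
have sqn (h : Om -> R) : wmean (fun o => (h o ^+ 2) `^ (p / 2)) =
    (wnorm p h ^+ 2) `^ (p / 2).
  rewrite (sqr_powR_half p (wnorm_ge0 p h)) (wnorm_powR h p0); apply: eq_wmean => o.
  by rewrite -(sqr_powR_half p (normr_ge0 (h o))) real_normK ?num_real.
apply: (wmean_minkowski r1 (sqr_ge0 _) g0).
- by move=> o; exact: sqr_ge0.
- by move=> o; apply: mulr_ge0 => //; exact: sqr_ge0.
- by rewrite sqn.
- rewrite (powRM _ p1 (sqr_ge0 _)) -sqn -wmeanZ; apply: wmean_le => o.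
  by rewrite (powRM _ p1 (sqr_ge0 _)).
Qed.

(** The hypothesis makes the linear term of the supporting line at [x] average to zero. *)
Lemma wnorm_le_orth p x y : 1 < p ->
  wmean (fun o => `|x o| `^ (p - 2) * x o * y o) = 0 ->
  wnorm p x <= wnorm p (fun o => x o + y o).
Proof.
move=> p1 orth; have p0 : 0 < p by lra.
apply: (powR_le_inv p0); rewrite ?wnorm_ge0 // !wnorm_powR //.
apply: (@le_trans _ _ (wmean (fun o => `|x o| `^ p +
    p * (`|x o| `^ (p - 2) * x o * y o)))).
  by rewrite wmeanD wmeanZ orth mulr0 addr0.
apply: wmean_le => o; have := powR_tangent (x o) (x o + y o) p1.
by apply: le_trans; rewrite lerD2l le_eqVlt; apply/orP; left; apply/eqP; ring.
Qed.

(** The hypothesis says that [y] has conditional mean zero given [x]. Smoothness used once, with |x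
    - y| >= |x|, would give the factor 2 (p - 1); small steps along [y] remove the 2. *)
Lemma wnorm_martingale p x y : 2 <= p ->
  (forall g : R -> R, wmean (fun o => g (x o) * y o) = 0) ->
  wnorm p (fun o => x o + y o) ^+ 2 <=
  wnorm p x ^+ 2 + (p - 1) * wnorm p y ^+ 2.
Proof.
move=> p2 orth; have p0 : 0 < p by lra.
set C := (p - 1) * wnorm p y ^+ 2.
have C0 : 0 <= C by rewrite mulr_ge0 ?exprn_ge0 ?wnorm_ge0 //; lra.
(* Smoothness bounds the second differences of [f] of step [h] by [2 C h^2], and
   orthogonality makes [f] minimal at [0]; summing twice with [h = 1/m] gives
   [f 1 <= f 0 + C (1 + 1/m)]. *)
pose f s := wnorm p (fun o => x o + s * y o) ^+ 2.
have fD s h : f (s + h) + f (s - h) <= 2 * f s + 2 * C * h ^+ 2.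
  have := @wnorm_smooth p (fun o => x o + s * y o) (fun o => h * y o)
    (fun o => x o + (s + h) * y o) (fun o => x o + (s - h) * y o) p2.
  rewrite wnormZ // exprMn real_normK ?num_real // -/(f s) -/(f (s + h)) -/(f (s - h)).
  move=> sm; have {sm} := sm (fun o => ltac:(ring)) (fun o => ltac:(ring)).
  have -> : (p - 1) * (h ^+ 2 * wnorm p y ^+ 2) = C * h ^+ 2 by rewrite /C; ring.
  clearbody f C; lra.
have f0 s : f 0 <= f s.
  rewrite /f ler_sqr ?nnegrE ?wnorm_ge0 //.
  have -> : (fun o => x o + 0 * y o) = x by apply/funext => o; rewrite mul0r addr0.
  apply: wnorm_le_orth; first lra.
  rewrite -[RHS](mulr0 s) -(orth (fun z => `|z| `^ (p - 2) * z)) -wmeanZ.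
  by apply: eq_wmean => o; ring.
have incr h k : f (k.+1%:R * h) - f (k%:R * h) <= 2 * C * h ^+ 2 * k.+1%:R.
  elim: k => [|k IH].
    have := fD 0 h; have := f0 (- h); rewrite mul1r mul0r add0r sub0r; lra.
  have := fD (k.+1%:R * h) h.
  have -> : k.+1%:R * h + h = k.+2%:R * h by rewrite -(natr1 k.+1); ring.
  have -> : k.+1%:R * h - h = k%:R * h by rewrite -(natr1 k); ring.
  by rewrite -(natr1 k.+1); lra.
have bnd h k : f (k%:R * h) <= f 0 + C * h ^+ 2 * (k%:R * (k%:R + 1)).
  elim: k => [|k IH]; first by rewrite !mul0r mulr0 addr0.
  by have := incr h k; rewrite -(natr1 k) in IH *; lra.
have lim m : f 1 - f 0 - C <= C / m.+1%:R.
  have := bnd (m.+1%:R)^-1 m.+1; rewrite divff ?pnatr_eq0 //.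
  have aux (q : R) : q != 0 -> C * q^-1 ^+ 2 * (q * (q + 1)) = C + C / q.
    by move=> q0; field.
  rewrite aux ?pnatr_eq0 //; clearbody f C; move: (C / _) => z; lra.
suff : f 1 - f 0 - C <= 0.
  have -> : f 0 = wnorm p x ^+ 2 by rewrite /f; congr (wnorm p _ ^+ 2);
    apply/funext => o; rewrite mul0r addr0.
  have -> : f 1 = wnorm p (fun o => x o + y o) ^+ 2.
    by rewrite /f; congr (wnorm p _ ^+ 2); apply/funext => o; rewrite mul1r.
  lra.
rewrite leNgt; apply/negP => D0.
set D := f 1 - f 0 - C in lim D0.
have := archi_boundP (divr_ge0 C0 (ltW D0)); set m := Num.bound _.
rewrite ltr_pdivrMr // => hm.
have := lim m; rewrite ler_pdivlMr // => hm'.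
have : D * m%:R <= D * m.+1%:R by rewrite ler_wpM2l ?ler_nat // ltW.
lra.
Qed.

Lemma Lp_le_martingale p x y a b : 2 <= p -> Lp_le p x a -> Lp_le p y b ->
  (forall g : R -> R, wmean (fun o => g (x o) * y o) = 0) ->
  Lp_le p (fun o => x o + y o) (Num.sqrt (a ^+ 2 + p * b ^+ 2)).
Proof.
move=> p2 xa yb orth; have p0 : 0 < p by lra.
have [a0 _] := xa; have [b0 _] := yb.
move: xa yb => /Lp_leP-/(_ p0) xa /Lp_leP-/(_ p0) yb; apply/Lp_leP => //.
rewrite -(ler_pXn2r (n := 2)) ?nnegrE ?sqrtr_ge0 ?wnorm_ge0 // sqr_sqrtr; last first.
  by rewrite addr_ge0 ?mulr_ge0 ?sqr_ge0 // ltW.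
apply: le_trans (wnorm_martingale p2 orth) _.
have xa2 : wnorm p x ^+ 2 <= a ^+ 2 by rewrite ler_sqr ?nnegrE ?wnorm_ge0.
have yb2 : wnorm p y ^+ 2 <= b ^+ 2 by rewrite ler_sqr ?nnegrE ?wnorm_ge0.
apply: lerD => //; apply: ler_pM => //; [lra|exact: sqr_ge0|lra].
Qed.

(** * Sub-Gaussian functions and Azuma's inequality *)

Definition wsup_le (f : Om -> R) (a : R) : Prop :=
  0 <= a /\ forall o, 0 < w o -> `|f o| <= a.

Definition sub_gauss_le (f : Om -> R) (a : R) : Prop :=
  0 <= a /\ forall l, wmean (fun o => expR (l * f o)) <= expR (l ^+ 2 * a ^+ 2 / 2).

(** The exponential moments at 2 and -2 are at most 1, so exp f - exp (-f) has mean square at most 1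
    + 1 - 2 = 0. *)
Lemma sub_gauss_le0 f : sub_gauss_le f 0 -> forall o, 0 < w o -> f o = 0.
Proof.
move=> [_ f0] o wo.
have sq o' : (expR (f o') - expR (- f o')) ^+ 2 =
    expR (2 * f o') + (expR (- 2 * f o') + (- 2)).
  have e1 : expR (f o') * expR (- f o') = 1 by rewrite -expRD subrr expR0.
  have e2 : expR (2 * f o') = expR (f o') ^+ 2 by rewrite expr2 -expRD; congr expR; ring.
  have e3 : expR (- 2 * f o') = expR (- f o') ^+ 2 by rewrite expr2 -expRD; congr expR; ring.
  by rewrite e2 e3; ring: e1.
have := @wmean_le0 (fun o' => (expR (f o') - expR (- f o')) ^+ 2) (fun o' => sqr_ge0 _).
rewrite (eq_wmean sq) !wmeanD wmean_cst.
have := f0 2; have := f0 (- 2); rewrite expr0n /= !mulr0 !mul0r expR0 => h1 h2.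
move=> /(_ ltac:(lra) o)[w_eq0|/eqP]; first by rewrite w_eq0 ltxx in wo.
by rewrite sqrf_eq0 subr_eq0 => /eqP/expR_inj; lra.
Qed.

(** The summands may be dependent: convexity of exp with weights a/(a+b) and b/(a+b) plays the role
    of Hoelder's inequality and makes the constants add. *)
Lemma sub_gauss_leD f g a b : sub_gauss_le f a -> sub_gauss_le g b ->
  sub_gauss_le (fun o => f o + g o) (a + b).
Proof.
move=> fa gb; have [a0 _] := fa; have [b0 _] := gb.
split=> [|l]; first exact: addr_ge0.
have [ea|aN0] := eqVneq a 0.
  rewrite ea in fa *; rewrite add0r; apply: le_trans (gb.2 l).
  by apply: wmean_le_supp => o /(sub_gauss_le0 fa) ->; rewrite add0r.
have [eb|bN0] := eqVneq b 0.
  rewrite eb in gb *; rewrite addr0; apply: le_trans (fa.2 l).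
  by apply: wmean_le_supp => o /(sub_gauss_le0 gb) ->; rewrite addr0.
have {aN0} {}a0 : 0 < a by rewrite lt_neqAle eq_sym aN0.
have {bN0} {}b0 : 0 < b by rewrite lt_neqAle eq_sym bN0.
have ab : 0 < a + b by rewrite addr_gt0.
pose s := a / (a + b); pose t := b / (a + b).
have s0 : 0 <= s by rewrite divr_ge0 // ltW.
have t0 : 0 <= t by rewrite divr_ge0 // ltW.
have st : s + t = 1 by rewrite -mulrDl divff // gt_eqF.
pose F o := - (l ^+ 2 * (a + b) ^+ 2 / 2) + l / s * f o + (- (l ^+ 2 * (a + b) ^+ 2 / 2) + l / t * g o).
have Fl k (h : Om -> R) c : 0 < c -> sub_gauss_le h c ->
    wmean (fun o => expR (- (l ^+ 2 * (a + b) ^+ 2 / 2) + l / (c / (a + b)) * h o)) <= 1 + k * 0.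
  move=> c0 [_ hc]; under eq_wmean => o do rewrite expRD.
  rewrite wmeanZ mulr0 addr0 expRN ler_pdivrMl ?expR_gt0 // mulr1.
  apply: le_trans (hc _) _; rewrite le_eqVlt; apply/orP; left; apply/eqP.
  by congr expR; field; rewrite !gt_eqF.
have := Fl 0 _ _ a0 fa; have := Fl 0 _ _ b0 gb; rewrite mulr0 addr0 -/s -/t => Fg Ff.
rewrite -[X in _ <= X]mulr1 -ler_pdivrMl ?expR_gt0 // -expRN -wmeanZ.
rewrite -[X in _ <= X]st -[s]mulr1 -[t]mulr1.
apply: (@le_trans _ _ (wmean (fun o => s * expR (- (l ^+ 2 * (a + b) ^+ 2 / 2) + l / s * f o)
    + t * expR (- (l ^+ 2 * (a + b) ^+ 2 / 2) + l / t * g o)))).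
  apply: wmean_le => o; rewrite -expRD.
  apply: le_trans (expR_conv _ _ s0 t0 st).
  rewrite le_eqVlt; apply/orP; left; apply/eqP; congr expR.
  by rewrite /s /t; field; rewrite !gt_eqF.
by rewrite wmeanD !wmeanZ; apply: lerD; apply: ler_wpM2l.
Qed.

Lemma sub_gauss_leZ f a c : sub_gauss_le f a -> sub_gauss_le (fun o => c * f o) (`|c| * a).
Proof.
move=> [a0 fa]; split=> [|l]; first exact: mulr_ge0.
under eq_wmean => o do rewrite mulrA.
apply: le_trans (fa _) _; rewrite le_eqVlt; apply/orP; left; apply/eqP; congr expR.
by rewrite [in RHS]exprMn real_normK ?num_real // exprMn; ring.
Qed.

Lemma sub_gauss_le_trans f a b : sub_gauss_le f a -> a <= b -> sub_gauss_le f b.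
Proof.
move=> [a0 fa] ab; split=> [|l]; first exact: le_trans ab.
apply: le_trans (fa l) _; rewrite ler_expR ler_pM2r ?invr_gt0 //.
by rewrite ler_wpM2l ?sqr_ge0 // ler_sqr ?nnegrE // (le_trans a0).
Qed.

(** On [-b, b] the function exp (l y) lies below its chord [ch] + [sh] y. The linear part averages
    to zero, and [ch] = cosh (l b) is bounded by [cosh_le]. *)
Lemma sub_gauss_le_martingale x y a b : sub_gauss_le x a -> wsup_le y b ->
  (forall g : R -> R, wmean (fun o => g (x o) * y o) = 0) ->
  sub_gauss_le (fun o => x o + y o) (Num.sqrt (a ^+ 2 + b ^+ 2)).
Proof.
move=> [a0 xa] [b0 yb] orth; split=> [|l]; first exact: sqrtr_ge0.
rewrite sqr_sqrtr ?addr_ge0 ?sqr_ge0 // mulrDr mulrDl expRD.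
have [eb|bN0] := eqVneq b 0.
  rewrite eb expr0n /= mulr0 mul0r expR0 mulr1; apply: le_trans (xa l).
  apply: wmean_le_supp => o /yb; rewrite eb normr_le0 => /eqP ->.
  by rewrite addr0.
have {bN0} {}b0 : 0 < b by rewrite lt_neqAle eq_sym bN0.
set ch := (expR (l * b) + expR (- (l * b))) / 2.
have ch0 : 0 <= ch by rewrite divr_ge0 // addr_ge0 // expR_ge0.
pose sh := (expR (l * b) - expR (- (l * b))) / (2 * b).
apply: (@le_trans _ _ (wmean (fun o => ch * expR (l * x o) + sh * (expR (l * x o) * y o)))).
  apply: wmean_le_supp => o /yb; rewrite ler_norml => /andP[y1 y2].
  have s0 : 0 <= (b + y o) / (2 * b) by rewrite divr_ge0; lra.
  have t0 : 0 <= (b - y o) / (2 * b) by rewrite divr_ge0; lra.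
  have st : (b + y o) / (2 * b) + (b - y o) / (2 * b) = 1 by field; rewrite gt_eqF.
  have := expR_conv (l * b) (- (l * b)) s0 t0 st.
  have -> : (b + y o) / (2 * b) * (l * b) + (b - y o) / (2 * b) * - (l * b) = l * y o.
    by field; rewrite gt_eqF.
  move=> /(ler_wpM2l (expR_ge0 (l * x o))); rewrite -expRD -mulrDr => /le_trans; apply.
  rewrite le_eqVlt; apply/orP; left; apply/eqP; rewrite /ch /sh; field; rewrite gt_eqF //.
rewrite wmeanD !wmeanZ (orth (fun z => expR (l * z))) mulr0 addr0 mulrC.
apply: ler_pM => //; first by apply: wmean_ge0 => o; exact: expR_ge0.
by apply: le_trans (cosh_le _) _; rewrite exprMn.
Qed.

End WeightedNorms.

(* [nI f a] and [nO f a] say that [f] is bounded by [a] in the norm used for the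
   martingale steps, respectively for their sums: L^p twice, or the supremum
   norm and the sub-Gaussian norm. *)
Record chaining_norms (R : realType) (Om : finType) (w : Om -> R) (kap : R)
    (nI nO : (Om -> R) -> R -> Prop) : Prop := ChainingNorms {
  nI_ge0 : forall f a, nI f a -> 0 <= a;
  nI_trans : forall f a b, nI f a -> a <= b -> nI f b;
  nI_0 : nI (fun=> 0) 0;
  nI_D : forall f g a b, nI f a -> nI g b -> nI (fun o => f o + g o) (a + b);
  nI_N : forall f a, nI f a -> nI (fun o => - f o) a;
  nO_trans : forall f a b, nO f a -> a <= b -> nO f b;
  nO_0 : nO (fun=> 0) 0;
  nO_D : forall f g a b, nO f a -> nO g b -> nO (fun o => f o + g o) (a + b);
  nO_Z : forall f a c, 0 <= c -> nO f a -> nO (fun o => c * f o) (c * a);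
  nO_step : forall x y a b, nO x a -> nI y b ->
    (forall g : R -> R, wmean w (fun o => g (x o) * y o) = 0) ->
    nO (fun o => x o + y o) (Num.sqrt (a ^+ 2 + kap * b ^+ 2))
}.

Lemma Lp_chaining_norms (R : realType) (Om : finType) (w : Om -> R) (p : R) :
  (forall o, 0 <= w o) -> \sum_o w o = 1 -> 2 <= p ->
  chaining_norms w p (Lp_le w p) (Lp_le w p).
Proof.
move=> w0 w1 p2; have p0 : 0 < p by lra.
have p1 : 1 <= p by lra.
have zero : Lp_le w p (fun=> 0) 0.
  split=> //; rewrite (eq_wmean w (g := fun=> 0)) ?wmean_cst ?powR_ge0 // => o.
  by rewrite normr0 powR0 ?gt_eqF.
have Z f a c : Lp_le w p f a -> Lp_le w p (fun o => c * f o) (`|c| * a).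
  exact: Lp_leZ.
split=> //.
- by move=> f a [].
- by move=> f a b fa; exact: Lp_le_trans.
- by move=> f g a b; exact: Lp_leD.
- move=> f a /(Z _ _ (-1)); rewrite normrN normr1 mul1r.
  by under [X in Lp_le w p X]funext do rewrite mulN1r.
- by move=> f a b fa; exact: Lp_le_trans.
- by move=> f g a b; exact: Lp_leD.
- by move=> f a c c0 /(Z _ _ c); rewrite ger0_norm.
- by move=> x y a b; exact: Lp_le_martingale.
Qed.

Lemma sub_gauss_chaining_norms (R : realType) (Om : finType) (w : Om -> R) :
  (forall o, 0 <= w o) -> \sum_o w o = 1 ->
  chaining_norms w 1 (wsup_le w) (sub_gauss_le w).
Proof.
move=> w0 w1; split=> //.
- by move=> f a [].
- by move=> f a b [a0 fa] ab; split=> [|o /fa h]; [exact: le_trans ab|exact: le_trans h ab].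
- by split=> // o _; rewrite normr0.
- move=> f g a b [a0 fa] [b0 gb]; split=> [|o wo]; first exact: addr_ge0.
  by apply: le_trans (ler_normD _ _) _; rewrite lerD ?fa ?gb.
- by move=> f a [a0 fa]; split=> // o wo; rewrite normrN fa.
- by move=> f a b fa; exact: sub_gauss_le_trans.
- split=> // l; rewrite (eq_wmean w (g := fun=> 1)) => [|o]; last by rewrite mulr0 expR0.
  by rewrite wmean_cst // expr0n /= mulr0 mul0r expR0.
- by move=> f g a b; exact: sub_gauss_leD.
- by move=> f a c c0 fa; have := sub_gauss_leZ c fa; rewrite ger0_norm.
- by move=> x y a b; rewrite mul1r; exact: sub_gauss_le_martingale.
Qed.

(** * Chaining of conditional expectations *)

Section Chaining.
Context {R : realType} {I V : finType}.
Notation Om := {ffun I -> V}.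
Variable w : Om -> R.
Hypothesis w_ge0 : forall o, 0 <= w o.
Hypothesis w_sum1 : \sum_o w o = 1.

Definition agree (U : {set I}) (o o' : Om) := [forall u in U, o u == o' u].

Lemma agreeP (U : {set I}) (o o' : Om) :
  reflect (forall u, u \in U -> o u = o' u) (agree U o o').
Proof. exact: 'forall_in_eqP. Qed.

Lemma agree_refl U o : agree U o o. Proof. exact/agreeP. Qed.

Lemma agree_sym U o o' : agree U o o' = agree U o' o.
Proof. by apply: eq_forallb => u; rewrite eq_sym. Qed.

Lemma agree_trans U o1 o2 o3 : agree U o1 o2 -> agree U o1 o3 = agree U o2 o3.
Proof.
move/agreeP => h; apply: eq_forallb => u.
by apply: implyb_id2l => uU; rewrite h.
Qed.

Definition depends (U : {set I}) (f : Om -> R) :=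
  forall o o', agree U o o' -> f o = f o'.

Lemma depends_sub (U1 U2 : {set I}) f : U1 \subset U2 -> depends U1 f -> depends U2 f.
Proof.
move=> /fintype.subsetP U12 h o o' /agreeP oo'; apply: h; apply/agreeP => u uU.
exact/oo'/U12.
Qed.

(** Conditional expectation given the coordinates in [U]. On a class of weight zero it is 0 by the
    convention on division; such classes never count in [wmean]. *)
Definition cexp (U : {set I}) (f : Om -> R) (o : Om) : R :=
  (\sum_(o' | agree U o o') w o' * f o') / \sum_(o' | agree U o o') w o'.

Lemma cexp_depends U f : depends U (cexp U f).
Proof.
by move=> o o' oo'; congr (_ / _); apply: eq_bigl => o2; exact: agree_trans.
Qed.

Lemma wmean_cexp U f h : depends U h ->
  wmean w (fun o => h o * cexp U f o) = wmean w (fun o => h o * f o).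
Proof.
move=> hU; rewrite /wmean.
under eq_bigr => o _.
  rewrite /cexp mulrA mulr_suml mulr_sumr.
  over.
rewrite (exchange_big_dep predT) //=; apply: eq_bigr => o' _.
rewrite (eq_bigr (fun o => w o * (h o' * (w o' * f o') /
    \sum_(o2 | agree U o' o2) w o2))); last first.
  move=> o oo'; rewrite (hU _ _ oo') -!mulrA; congr (_ * (_ * (_ * (_ * _^-1)))).
  by apply: eq_bigl => o2; exact: agree_trans.
rewrite -mulr_suml (eq_bigl (agree U o')); last by move=> o; exact: agree_sym.
set W := \sum_(_ | _) _.
have [W0|W0] := eqVneq W 0; last by field.
suff -> : w o' = 0 by rewrite !(mul0r, mulr0).
by apply: (psumr_eq0P (P := agree U o') (F := w)) => //; exact: agree_refl.
Qed.

Lemma cexp0 f o : cexp finset.set0 f o = wmean w f.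
Proof.
have e o' : agree finset.set0 o o' = true by apply/agreeP => u; rewrite inE.
rewrite /cexp (eq_bigl predT) // [X in _ / X](eq_bigl predT) //.
by rewrite w_sum1 divr1.
Qed.

Variables (kap : R) (nI nO : (Om -> R) -> R -> Prop).
Hypothesis kap_ge0 : 0 <= kap.
Hypothesis norms : chaining_norms w kap nI nO.
(** [rho j t] is the place of the level-[j] block of [t] in the order of the blocks, [s j] bounds
    the size of such a block, and [a j] the norm of [x t] conditioned on [past t j]. *)
Variables (J : {set I}) (K : nat) (rho : nat -> I -> nat) (x : I -> Om -> R).
Variables (a s : nat -> R).

(* [past t 0] includes [t] itself, so that [x t] may be measurable with respect
   to it, while [past t j.+1] consists of the strictly earlier level-[j] blocks. *)
Definition past (t : I) (j : nat) : {set I} :=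
  if j is j'.+1 then [set u in J | rho j' u < rho j' t]%N
  else [set u in J | rho 0 u <= rho 0 t]%N.

Hypothesis rho_mono : forall j u t, (j < K)%N -> u \in J -> t \in J ->
  (rho j.+1 u < rho j.+1 t)%N -> (rho j u < rho j t)%N.
Hypothesis rho_top : forall u t, u \in J -> t \in J -> (rho K u < rho K t)%N = false.
Hypothesis x_mean : forall t, t \in J -> wmean w (x t) = 0.
Hypothesis rho_size : forall j r, (j <= K)%N ->
  #|[set t in J | rho j t == r]|%:R <= s j.
Hypothesis x_norm : forall j t, (j <= K.+1)%N -> t \in J ->
  nI (cexp (past t j) (x t)) (a j).
Hypothesis a_decr : forall j, (j <= K)%N -> a j.+1 <= a j.

Lemma past_le j u t : (j <= K)%N -> t \in J -> u \in past t j ->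
  (u \in J) && (rho j u <= rho j t)%N.
Proof.
case: j => [|j] jK tJ; rewrite !inE => /andP[uJ ut]; rewrite uJ //=.
rewrite leqNgt; apply: contraTN ut => tu; rewrite -leqNgt.
by rewrite ltnW // (rho_mono jK).
Qed.

Lemma past_decr j t : (j <= K)%N -> t \in J -> past t j.+1 \subset past t j.
Proof.
move=> jK tJ; apply/fintype.subsetP => u; rewrite inE => /andP[uJ ut].
case: j jK ut => [|j] jK ut; rewrite inE uJ /=; first exact: ltnW.
exact: rho_mono.
Qed.

Definition incr (j : nat) (t : I) (o : Om) : R :=
  cexp (past t j) (x t) o - cexp (past t j.+1) (x t) o.

Lemma incr_norm j t : (j <= K)%N -> t \in J -> nI (incr j t) (2 * a j).
Proof.
move=> jK tJ; rewrite mulr_natl mulr2n; apply: (nI_D norms).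
  by apply: x_norm => //; exact: leqW.
apply: (nI_N norms); apply: (nI_trans norms (x_norm _ tJ)) => //; exact: a_decr.
Qed.

Lemma incr_orth j t h : (j <= K)%N -> t \in J -> depends (past t j.+1) h ->
  wmean w (fun o => h o * incr j t o) = 0.
Proof.
move=> jK tJ hU; rewrite /incr.
rewrite (eq_wmean w (g := fun o => h o * cexp (past t j) (x t) o +
   -1 * (h o * cexp (past t j.+1) (x t) o))); last by move=> o; ring.
rewrite wmeanD wmeanZ !wmean_cexp ?mulN1r ?subrr //.
exact: depends_sub (past_decr jK tJ) hU.
Qed.

Definition block (j r : nat) : {set I} := [set t in J | rho j t == r].

Lemma nI_sum (B : {set I}) (F : I -> Om -> R) b : (forall t, t \in B -> nI (F t) b) ->
  nI (fun o => \sum_(t in B) F t o) (#|B|%:R * b).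
Proof.
move=> FB; rewrite cardE.
have {FB} : {in enum B, forall t, nI (F t) b}.
  by move=> t; rewrite mem_enum; exact: FB.
have -> : (fun o => \sum_(t in B) F t o) = (fun o => \sum_(t <- enum B) F t o).
  by apply/funext => o; rewrite big_enum.
elim: (enum B) => [_|t r IH FB].
  have -> : (fun o => \sum_(t <- [::]) F t o) = (fun=> 0).
    by apply/funext => o; rewrite big_nil.
  by rewrite mul0r; exact: nI_0 norms.
have -> : (fun o => \sum_(i <- t :: r) F i o) = (fun o => F t o + \sum_(i <- r) F i o).
  by apply/funext => o; rewrite big_cons.
rewrite /= -nat1r mulrDl mul1r; apply: (nI_D norms).
  by apply: FB; rewrite mem_head.
by apply: IH => i ir; apply: FB; rewrite inE ir orbT.
Qed.

Lemma card_blocks j rmax : (forall t, t \in J -> (rho j t < rmax)%N) ->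
  (\sum_(i < rmax) #|block j i| = #|J|)%N.
Proof.
move=> Jlt; rewrite -[RHS]sum1_card.
rewrite (eq_bigr (fun i : 'I_rmax => \sum_(t in block j i) 1)%N); last first.
  by move=> i _; rewrite sum1_card.
rewrite (exchange_big_dep (fun t => t \in J)) /=; last by move=> i t _; rewrite inE => /andP[].
apply: eq_bigr => t tJ; rewrite (big_pred1 (Ordinal (Jlt t tJ))) // => i.
by rewrite inE tJ /= eq_sym -val_eqE.
Qed.

(** Adding the blocks one at a time in the order of [rho j] gives a martingale with steps at most 2
    [a j] times the block size; the squared block sizes sum to at most [s j] times the size of
    [J]. *)
Lemma level_norm j : (j <= K)%N ->
  nO (fun o => \sum_(t in J) incr j t o)
     (Num.sqrt kap * (2 * a j) * Num.sqrt (s j * #|J|%:R)).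
Proof.
move=> jK.
have [J0|[t0 t0J]] := finset.set_0Vmem J.
  have -> : (fun o => \sum_(t in J) incr j t o) = (fun=> 0).
    by apply/funext => o; rewrite J0 big_set0.
  by rewrite J0 cards0 mulr0 sqrtr0 mulr0; exact: nO_0 norms.
have a0 : 0 <= 2 * a j := nI_ge0 norms (incr_norm jK t0J).
pose b r := #|block j r|%:R * (2 * a j).
pose S r o := \sum_(t in J | (rho j t < r)%N) incr j t o.
have SP r : nO (S r) (Num.sqrt (kap * \sum_(i < r) b i ^+ 2)).
  elim: r => [|r IH].
    have -> : S 0 = (fun=> 0).
      by apply/funext => o; rewrite /S big_pred0 // => t; rewrite ltn0 andbF.
    by rewrite big_ord0 mulr0 sqrtr0; exact: nO_0 norms.
  have -> : S r.+1 = (fun o => S r o + \sum_(t in block j r) incr j t o).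
    apply/funext => o; rewrite /S (bigID (fun t => (rho j t < r)%N)) /=; congr (_ + _).
      apply: eq_bigl => t; rewrite -andbA; congr andb; rewrite ltnS.
      by apply/andb_idl => /ltnW.
    by apply: eq_bigl => t; rewrite inE -andbA; congr andb; rewrite ltnS -leqNgt -eqn_leq.
  have b0 : 0 <= kap * \sum_(i < r) b i ^+ 2.
    by apply: mulr_ge0 => //; apply: sumr_ge0 => i _; exact: sqr_ge0.
  rewrite big_ord_recr /= mulrDr -[in X in X + _](sqr_sqrtr b0).
  apply: (nO_step norms IH).
    by apply: nI_sum => t; rewrite inE => /andP[tJ _]; exact: incr_norm.
  move=> g.
  (* An increment at a point of an earlier block involves only coordinates of blocks up to its own,
     and these all lie in [past t j.+1]. *)
  have Sdep t : rho j t = r -> depends (past t j.+1) (fun o => g (S r o)).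
    move=> tr o o' oo'; congr g; apply: eq_bigr => u /andP[uJ ur].
    congr (_ - _); apply: cexp_depends; apply/agreeP => v vu;
      (move/agreeP: oo'; apply); rewrite inE tr.
      by have /andP[-> /leq_ltn_trans->] := past_le jK uJ vu.
    have := fintype.subsetP (past_decr jK uJ) _ vu => vu'.
    by have /andP[-> /leq_ltn_trans->] := past_le jK uJ vu'.
  rewrite /wmean; under eq_bigr do rewrite mulr_sumr mulr_sumr.
  rewrite exchange_big big1 // => t; rewrite inE => /andP[tJ /eqP tr].
  exact: incr_orth (Sdep t tr).
pose rmax := (\max_(t in J) rho j t).+1.
have Jlt t : t \in J -> (rho j t < rmax)%N.
  by move=> tJ; rewrite ltnS; exact: leq_bigmax_cond.
have -> : (fun o => \sum_(t in J) incr j t o) = S rmax.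
  apply/funext => o; apply: eq_bigl => t.
  by case tJ: (t \in J) => //=; rewrite Jlt.
apply: (nO_trans norms (SP _)).
rewrite (sqrtrM _ kap_ge0) -mulrA; apply: ler_wpM2l; first exact: sqrtr_ge0.
rewrite -[X in _ <= X * _](ger0_norm a0) -sqrtr_sqr -sqrtrM ?sqr_ge0 //.
apply: ler_wsqrtr; rewrite mulrC -(card_blocks Jlt) natr_sum mulr_sumr mulr_suml.
apply: ler_sum => i _; rewrite /b exprMn; apply: ler_wpM2r; first exact: sqr_ge0.
by rewrite expr2; apply: ler_wpM2r => //; exact: rho_size.
Qed.

(** Nothing strictly precedes the single top block, so conditioning reduces to the mean; this ends
    the telescoping. *)
Lemma cexp_past_top t o : t \in J -> cexp (past t K.+1) (x t) o = 0.
Proof.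
move=> tJ; have -> : past t K.+1 = finset.set0.
  apply/finset.setP => u; rewrite !inE; apply/negP => /andP[uJ].
  by rewrite rho_top.
by rewrite cexp0 x_mean.
Qed.

Lemma chaining_bound :
  nO (fun o => \sum_(t in J) cexp (past t 0) (x t) o)
     (\sum_(j < K.+1) Num.sqrt kap * (2 * a j) * Num.sqrt (s j * #|J|%:R)).
Proof.
have -> : (fun o => \sum_(t in J) cexp (past t 0) (x t) o) =
    (fun o => \sum_(j < K.+1) \sum_(t in J) incr j t o).
  apply/funext => o; rewrite exchange_big; apply: eq_bigr => t tJ.
  rewrite -(big_mkord predT (fun j => incr j t o)).
  rewrite (@telescope_sumr_eq _ 0 K.+1 (fun j => - cexp (past t j) (x t) o)) //.
    by rewrite (cexp_past_top o tJ) oppr0 sub0r opprK.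
  by move=> j _; rewrite /incr opprK addrC.
have : (K.+1 <= K.+1)%N by [].
move: {-2}K.+1 => k; elim: k => [_|k IH kK].
  have -> : (fun o => \sum_(j < 0) \sum_(t in J) incr j t o) = (fun=> 0).
    by apply/funext => o; rewrite big_ord0.
  by rewrite big_ord0; exact: nO_0 norms.
have -> : (fun o => \sum_(j < k.+1) \sum_(t in J) incr j t o) =
    (fun o => \sum_(j < k) \sum_(t in J) incr j t o + \sum_(t in J) incr k t o).
  by apply/funext => o; rewrite big_ord_recr.
rewrite big_ord_recr; apply: (nO_D norms); first exact/IH/ltnW.
exact: level_norm.
Qed.

End Chaining.

(** * Spaced product sets *)

(** Uniqueness of base-[W] digits, used to recover a vector of block indices from the integer that
    codes it. *)
Lemma digits_inj (W d : nat) (a b : 'I_d -> nat) :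
  (forall i, (a i < W)%N) -> (forall i, (b i < W)%N) ->
  (\sum_(i < d) a i * W ^ i = \sum_(i < d) b i * W ^ i)%N -> a =1 b.
Proof.
elim: d a b => [|d IH] a b aW bW; first by move=> _ [].
rewrite !big_ord_recl /= !expn0 !muln1.
have e (c : 'I_d.+1 -> nat) : (\sum_(i < d) c (lift ord0 i) * W ^ bump 0 i =
    W * \sum_(i < d) c (lift ord0 i) * W ^ i)%N.
  by rewrite big_distrr; apply: eq_bigr => i _; rewrite /bump /= expnS mulnCA.
rewrite !e => ab.
have W0 : (0 < W)%N := leq_ltn_trans (leq0n _) (aW ord0).
have := congr1 (modn^~ W) ab; rewrite /= !(addnC _ (W * _)%N) !(mulnC W) !modnMDl.
rewrite !modn_small // => ab0.
move: ab; rewrite ab0 => /addnI/eqP; rewrite eqn_pmul2l // => /eqP ab1.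
have h := IH (fun i => a (lift ord0 i)) (fun i => b (lift ord0 i))
  (fun i => aW _) (fun i => bW _) ab1.
by move=> i; case: (unliftP ord0 i) => [j ->|-> //]; exact: h.
Qed.

Section SpacedPositions.
Variables (h : nat -> nat) (k : nat).

(* A gap of length [h j] is inserted before each multiple of [2 ^ j], [j <= k]. *)
Definition pos (m : nat) : nat := (m + \sum_(j < k.+1) h j * (m %/ 2 ^ j))%N.

Lemma pos_lt m m' : (m < m')%N -> (pos m < pos m')%N.
Proof.
move=> mm; rewrite /pos -addSn leq_add //; apply: leq_sum => j _.
by rewrite leq_mul2l leq_div2r ?orbT // ltnW.
Qed.

Lemma pos_ltE m m' : (pos m < pos m')%N = (m < m')%N.
Proof.
by apply/idP/idP => [|/pos_lt //]; apply: contraTT; rewrite -!leqNgt leq_eqVlt =>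
  /predU1P[-> //|/pos_lt/ltnW].
Qed.

Lemma pos_leE m m' : (pos m <= pos m')%N = (m <= m')%N.
Proof. by rewrite leqNgt pos_ltE -leqNgt. Qed.

Lemma pos_inj : injective pos.
Proof. by move=> m m' e; apply/eqP; rewrite eqn_leq -(pos_leE m) -(pos_leE m') e leqnn. Qed.

Lemma leq_pos m : (m <= pos m)%N. Proof. exact: leq_addr. Qed.

(** A multiple of 2^j is also one of 2^l for l <= j, so all the gaps h 0, ..., h j are crossed
    between [u] and [t]. *)
Lemma pos_sep u t j : (j <= k)%N -> (u %/ 2 ^ j < t %/ 2 ^ j)%N ->
  (pos u + (\sum_(l < j.+1) h l).+1 <= pos t)%N.
Proof.
move=> jk utj.
have ut l : (l <= j)%N -> (u %/ 2 ^ l < t %/ 2 ^ l)%N.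
  move=> lj; rewrite ltnNge; apply: contraTN utj => /(leq_div2r (2 ^ (j - l))).
  by rewrite -!divnMA -expnD subnKC // -leqNgt.
have ut0 : (u < t)%N by have := ut 0%N isT; rewrite expn0 !divn1.
rewrite /pos -(big_mkord xpredT (fun l => h l * (u %/ 2 ^ l))%N).
rewrite -(big_mkord xpredT (fun l => h l * (t %/ 2 ^ l))%N).
rewrite -(big_mkord xpredT h) !(@big_cat_nat _ _ _ j.+1 0 k.+1) //=.
have h1 : (\sum_(0 <= i < j.+1) h i * (u %/ 2 ^ i) + \sum_(0 <= i < j.+1) h i <=
    \sum_(0 <= i < j.+1) h i * (t %/ 2 ^ i))%N.
  rewrite -big_split big_nat_cond [X in (_ <= X)%N]big_nat_cond.
  by apply: leq_sum => i; rewrite andbT ltnS /= => ij; rewrite -mulnSr leq_mul2l ut ?orbT.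
have h2 : (\sum_(j.+1 <= i < k.+1) h i * (u %/ 2 ^ i) <=
    \sum_(j.+1 <= i < k.+1) h i * (t %/ 2 ^ i))%N.
  by apply: leq_sum => i _; rewrite leq_mul2l leq_div2r ?orbT // ltnW.
lia.
Qed.

Definition period : nat := pos (2 ^ k).

Lemma posD m : pos (m + 2 ^ k) = (pos m + period)%N.
Proof.
rewrite /period /pos addnACA -big_split; congr (_ + _)%N; apply: eq_bigr => j _.
by rewrite divnDr ?mulnDr // dvdn_exp2l // -ltnS.
Qed.

(** Left inverse of [pos]: counts the positive integers whose position is at most [x]. They do not
    exceed [x], because [m <= pos m]. *)
Definition idx (x : nat) : nat := (\sum_(m < x) (pos m.+1 <= x))%N.

Definition sel (x : nat) : bool := pos (idx x) == x.

Lemma idx_le x : (idx x <= x)%N.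
Proof.
rewrite -[X in (_ <= X)%N]card_ord -sum1_card; apply: leq_sum => m _.
exact: leq_b1.
Qed.

Lemma idx_pos m : idx (pos m) = m.
Proof.
rewrite /idx; under eq_bigr do rewrite pos_leE.
rewrite -(big_mkord xpredT (fun i => (i < m)%N : nat)) (@big_cat_nat _ _ _ m) //=; last first.
  exact: leq_pos.
rewrite (@big_nat_cond _ _ _ m (pos m)) [X in (_ + X)%N]big1 => [|i]; last first.
  by rewrite andbT => /andP[mi _]; rewrite ltnNge mi.
rewrite addn0 (eq_big_nat _ _ (F2 := fun=> 1%N)) => [|i /andP[_ ->] //].
by rewrite sum_nat_const_nat subn0 muln1.
Qed.

Lemma sel_pos m : sel (pos m).
Proof. by rewrite /sel idx_pos. Qed.

Lemma selD x : sel (x + period) = sel x.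
Proof.
apply/eqP/eqP => [e|e]; last by rewrite -{1}e -posD idx_pos posD e.
set m := idx (x + period) in e.
have mk : (2 ^ k <= m)%N by rewrite -pos_leE e leq_addl.
have : pos (m - 2 ^ k) = x by apply: (@addIn period); rewrite -posD subnK.
by move=> <-; rewrite idx_pos.
Qed.

(** Sliding the window by one place exchanges two places that differ by a period; the window at 0
    holds the positions of 0, ..., 2^k - 1. *)
Lemma sel_count t : (\sum_(s < period) sel (t + s) = 2 ^ k)%N.
Proof.
elim: t => [|t IH].
  rewrite -[RHS]card_ord -[RHS](card_imset (f := fun m : 'I_(2 ^ k) => Ordinal
    (etrans (pos_ltE m (2 ^ k)) (ltn_ord m) : pos m < period)%N)); last first.
    by move=> m m' /(congr1 val) /= /pos_inj/val_inj.
  rewrite -sum1_card [RHS]big_mkcond; apply: eq_bigr => s _ /=.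
  have [ss|ss] := boolP (sel s).
    have ik : (idx s < 2 ^ k)%N by rewrite -pos_ltE (eqP ss).
    rewrite (_ : s \in _) //; apply/imsetP; exists (Ordinal ik) => //.
    by apply/val_inj; rewrite /= (eqP ss).
  rewrite ifN //; apply: contra ss => /imsetP[m _ ->]; exact: sel_pos.
rewrite -IH; apply: (@addnI (sel t)).
transitivity (\sum_(s < period.+1) sel (t + s))%N.
  rewrite big_ord_recl /= addn0; congr (_ + _)%N.
  by apply: eq_bigr => s _; rewrite /bump /= add1n addSnnS.
by rewrite big_ord_recr /= selD addnC.
Qed.

End SpacedPositions.

(* A point [t] is seen through the indices [ix t i] of its coordinates in the
   spaced sequence; its level-[j] block is the vector [ix t i %/ 2 ^ j], and
   [rank j] orders these blocks hierarchically, coarsest level first. *)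
Section HierarchicalOrder.
Variables (h : nat -> nat) (k d n : nat) (s : 'I_d -> nat).
Hypothesis d_gt0 : (0 < d)%N.
Hypothesis n_le : (n <= 2 ^ k.+1)%N.
Notation point := {ffun 'I_d -> 'I_n}.

Definition ix (t : point) (i : 'I_d) : nat := idx h k (t i + s i).

Definition selected : {set point} := [set t : point | [forall i, sel h k (t i + s i)]].

Lemma selectedP (t : point) : t \in selected ->
  forall i, pos h k (ix t i) = (t i + s i)%N.
Proof. by rewrite inE => /forallP ts i; exact/eqP/ts. Qed.

Definition base : nat := (\sum_i (n + s i)).+1.

Lemma ix_lt t i : (ix t i < base)%N.
Proof.
rewrite ltnS (bigD1 i) //=; apply: leq_trans (idx_le _ _ _) _.
by apply: leq_trans (leq_addr _ _); rewrite leq_add2r ltnW.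
Qed.

Definition weight (l : nat) (t : point) : nat :=
  (\sum_(i < d) (ix t i %/ 2 ^ l) * base ^ i)%N.

Definition radix : nat := (\sum_(i < d) base * base ^ i).+1.

Lemma weight_lt l t : (weight l t < radix)%N.
Proof.
rewrite ltnS; apply: leq_sum => i _; rewrite leq_mul2r; apply/orP; right.
by apply: leq_trans (leq_div _ _) _; rewrite ltnW // ix_lt.
Qed.

(** An integer in base [radix] whose digits are the block codes [weight l], with level [k] as the
    most significant one: comparing integers compares the levels from the coarsest down. *)
Fixpoint rank_rec (e : nat) (t : point) : nat :=
  if e is e'.+1 then (weight (k.+1 - e) t + radix * rank_rec e' t)%N else 0%N.

Definition rank (j : nat) (t : point) : nat := rank_rec (k.+1 - j) t.

Lemma rankE j t : (j <= k)%N -> rank j t = (weight j t + radix * rank j.+1 t)%N.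
Proof.
move=> jk; rewrite /rank (subSn jk) /= -(subSn jk) subKn ?subSS //; exact: leqW.
Qed.

Lemma rank_top t : rank k.+1 t = 0%N. Proof. by rewrite /rank subnn. Qed.

Lemma rank_mono j u t : (j < k.+1)%N -> (rank j.+1 u < rank j.+1 t)%N ->
  (rank j u < rank j t)%N.
Proof.
rewrite ltnS => jk ut; rewrite (rankE u jk) (rankE t jk).
have := weight_lt j u; move: (weight j u) (weight j t) => a b aV.
have : (radix * (rank j.+1 u).+1 <= radix * rank j.+1 t)%N by rewrite leq_mul2l ut orbT.
by rewrite mulnS; lia.
Qed.

Lemma rank_eq j u t : (j <= k)%N -> rank j u = rank j t ->
  forall i, (ix u i %/ 2 ^ j = ix t i %/ 2 ^ j)%N.
Proof.
move=> jk; rewrite (rankE u jk) (rankE t jk) => e.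
have := congr1 (modn^~ radix) e; rewrite /= !(addnC _ (radix * _)%N) !(mulnC radix) !modnMDl.
rewrite !modn_small ?weight_lt //; apply: digits_inj => i;
  by apply: leq_ltn_trans (leq_div _ _) _; exact: ix_lt.
Qed.

(** A comparison of all coordinates at level [j] persists at every coarser level. The contrapositive
    [rank_lt_ex] is what fits the pasts of the field: an earlier block is behind in at least one
    coordinate. *)
Lemma rank_le j u t : (forall i, (ix t i %/ 2 ^ j <= ix u i %/ 2 ^ j)%N) ->
  (rank j t <= rank j u)%N.
Proof.
move=> tu; suff le_rec e : (e <= k.+1 - j)%N -> (rank_rec e t <= rank_rec e u)%N.
  exact: le_rec.
elim: e => [//|e IH] ej /=; apply: leq_add.
  apply: leq_sum => i _; rewrite leq_mul2r; apply/orP; right.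
  have -> : (k.+1 - e.+1 = j + (k.+1 - e.+1 - j))%N by lia.
  by rewrite expnD !divnMA leq_div2r.
by rewrite leq_mul2l IH ?orbT // ltnW.
Qed.

Lemma rank_lt_ex j u t : (rank j u < rank j t)%N ->
  exists i, (ix u i %/ 2 ^ j < ix t i %/ 2 ^ j)%N.
Proof.
move=> ut; apply/existsP; apply: contraTT ut; rewrite negb_exists => /forallP tu.
by rewrite -leqNgt; apply: rank_le => i; rewrite leqNgt tu.
Qed.

(** Indexed like [past]: [gap j.+1] is the distance guaranteed to the earlier level-[j] blocks, one
    more than the inserted gaps, and [gap 0] is 0 as [past t 0] may contain [t]. *)
Definition gap (j : nat) : nat := if j is j'.+1 then (\sum_(l < j'.+1) h l).+1 else 0%N.

Lemma past_gap j u t : (j <= k.+1)%N -> t \in selected ->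
  u \in past selected rank t j -> exists i, (u i + gap j <= t i)%N.
Proof.
move=> jk ts; case: j jk => [_|j jk]; rewrite inE => /andP[us ut].
  (* If [u] exceeded [t] in all coordinates, their ranks would be equal, hence also their indices
     and positions. *)
  apply/existsP; apply: contraT; rewrite negb_exists => /forallP tu.
  have {}tu i : (t i < u i)%N by have := tu i; rewrite addn0 -ltnNge.
  have ixtu i : (ix t i <= ix u i)%N.
    by rewrite -(pos_leE h k) !selectedP // leq_add2r ltnW.
  have tu0 : (rank 0 t <= rank 0 u)%N by apply: rank_le => i; rewrite leq_div2r.
  have /rank_eq-/(_ isT) e : rank 0 t = rank 0 u by apply/eqP; rewrite eqn_leq tu0.
  pose i0 := Ordinal d_gt0.
  have := e i0; rewrite expn0 !divn1 => /(congr1 (pos h k)); rewrite !selectedP //.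
  by move=> /addIn e0; have := tu i0; rewrite e0 ltnn.
have [i ij] := rank_lt_ex ut; exists i.
have := @pos_sep h k (ix u i) (ix t i) j jk ij.
by rewrite !selectedP // -addnA (addnC (s i)) addnA leq_add2r.
Qed.

(** Inside a block the indices are determined by their residues modulo 2^j. At the top level the
    whole cube is the bound, through [n_le]. *)
Lemma block_size j r : (j <= k.+1)%N ->
  (#|[set t in selected | rank j t == r]| <= (2 ^ j) ^ d)%N.
Proof.
rewrite leq_eqVlt => /predU1P[->|jk].
  apply: leq_trans (max_card _) _; rewrite card_ffun !card_ord.
  by have [->|d0] := posnP d; rewrite ?expn0 // leq_exp2r.
have p0 : (0 < 2 ^ j)%N by rewrite expn_gt0.
pose f (t : point) := [ffun i => Ordinal (ltn_pmod (ix t i) p0)].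
rewrite -(card_in_imset (f := f)) => [|u t]; last first.
  rewrite !inE => /andP[us /eqP ur] /andP[ts /eqP tr] /ffunP fut.
  have e : rank j u = rank j t by rewrite ur tr.
  apply/ffunP => i; apply/val_inj.
  have := congr1 val (fut i); rewrite !ffunE /= => em.
  have : ix u i = ix t i.
    by rewrite (divn_eq (ix u i) (2 ^ j)) (divn_eq (ix t i) (2 ^ j)) em (rank_eq _ e).
  move=> /(congr1 (pos h k)); rewrite !selectedP ?inE //; exact: addIn.
by apply: leq_trans (max_card _) _; rewrite card_ffun !card_ord.
Qed.

End HierarchicalOrder.

(** The selection is a product over the axes, so the count factors into the window counts of
    [sel_count]. *)
Lemma selected_count (h : nat -> nat) (k d n : nat) (t : {ffun 'I_d -> 'I_n}) :
  (\sum_(s : {ffun 'I_d -> 'I_(period h k)}) (t \in selected h k n (fun i => s i : nat)) = (2 ^ k) ^ d)%N.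
Proof.
transitivity (\sum_(s : {ffun 'I_d -> 'I_(period h k)}) \prod_i sel h k (t i + s i))%N.
  apply: eq_bigr => s _; rewrite inE; case: (boolP [forall i, sel h k (t i + s i)]) => [/forallP a|].
    by rewrite big1 // => i _; rewrite a.
  by rewrite negb_forall => /existsP[i /negbTE a]; rewrite (bigD1 i) //= a.
rewrite -(bigA_distr_bigA (fun i (s : 'I_(period h k)) => (sel h k (t i + s) : nat))).
by rewrite (eq_bigr (fun=> 2 ^ k)%N) ?prod_nat_const ?card_ord // => i _; exact: sel_count.
Qed.

(** * Averaging over the shifts *)

Section AveragedChaining.
Context {R : realType} {V : finType}.
Variables (d n k : nat) (h : nat -> nat).
Hypothesis d_gt0 : (0 < d)%N.
Hypothesis n_le : (n <= 2 ^ k.+1)%N.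
Notation point := {ffun 'I_d -> 'I_n}.
Notation Om := {ffun point -> V}.
Notation shift := {ffun 'I_d -> 'I_(period h k)}.
Variable w : Om -> R.
Hypothesis w_ge0 : forall o, 0 <= w o.
Hypothesis w_sum1 : \sum_o w o = 1.
Variables (kap : R) (nI nO : (Om -> R) -> R -> Prop).
Hypothesis kap_ge0 : 0 <= kap.
Hypothesis norms : chaining_norms w kap nI nO.
Variables (x : point -> Om -> R) (a : nat -> R).
Hypothesis x_mean : forall t, wmean w (x t) = 0.
Hypothesis x_norm : forall j (t : point) (U : {set point}),
  (forall u, u \in U -> exists i, (u i + gap h j <= t i)%N) ->
  nI (cexp w U (x t)) (a j).
Hypothesis a_ge0 : forall j, 0 <= a j.
Hypothesis a_decr : forall j, a j.+1 <= a j.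

Lemma nO_sum (S : finType) (F : S -> Om -> R) b : (forall s, nO (F s) b) ->
  nO (fun o => \sum_s F s o) (#|S|%:R * b).
Proof.
move=> Fb; rewrite cardE.
have -> : (fun o => \sum_s F s o) = (fun o => \sum_(s <- enum S) F s o).
  by apply/funext => o; rewrite big_enum.
elim: (enum S) => [|s r IH].
  have -> : (fun o => \sum_(s <- [::]) F s o) = (fun=> 0).
    by apply/funext => o; rewrite big_nil.
  by rewrite mul0r; exact: nO_0 norms.
have -> : (fun o => \sum_(i <- s :: r) F i o) = (fun o => F s o + \sum_(i <- r) F i o).
  by apply/funext => o; rewrite big_cons.
by rewrite /= -nat1r mulrDl mul1r; exact: (nO_D norms).
Qed.

Definition shift_past (s : shift) (t : point) : {set point} :=
  past (selected h k n (fun i => s i : nat)) (rank h k (fun i => s i : nat)) t 0.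

Definition level_sum : R :=
  \sum_(j < k.+2) Num.sqrt kap * (2 * a j) * Num.sqrt ((2 ^ j) ^ d * n ^ d)%:R.

Lemma shift_bound (s : shift) :
  nO (fun o => \sum_(t in selected h k n (fun i => s i : nat))
        cexp w (shift_past s t) (x t) o) level_sum.
Proof.
apply: (nO_trans norms); first apply: (chaining_bound (K := k.+1)
  (s := fun j => ((2 ^ j) ^ d)%:R) w_ge0 w_sum1 kap_ge0 norms) => //.
- by move=> j u t jk _ _; exact: rank_mono.
- by move=> u t _ _; rewrite !rank_top.
- by move=> j r jk; rewrite ler_nat; exact: block_size.
- move=> j t; rewrite leq_eqVlt => /predU1P[-> ts|jk ts].
    apply: x_norm => u; rewrite inE !rank_top ltnn andbF //.
  by apply: x_norm => u; exact: past_gap.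
- apply: ler_sum => j _; apply: ler_wpM2l.
    by rewrite mulr_ge0 ?sqrtr_ge0 ?mulr_ge0.
  apply: ler_wsqrtr; rewrite -natrM ler_nat leq_mul2l; apply/orP; right.
  by apply: leq_trans (max_card _) _; rewrite card_ffun !card_ord.
Qed.

Lemma averaged_bound c : 0 <= c ->
  nO (fun o => c * \sum_(s : shift) \sum_(t in selected h k n (fun i => s i : nat))
        cexp w (shift_past s t) (x t) o) (c * ((period h k ^ d)%:R * level_sum)).
Proof.
move=> c0; apply: (nO_Z norms) => //.
have := nO_sum shift_bound.
by rewrite card_ffun !card_ord.
Qed.

End AveragedChaining.

(** * Choice of the gaps *)

Section GapChoice.
Context {R : realType}.
Variables (d k : nat) (alpha : R).
Hypothesis d_gt0 : (0 < d)%N.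
Hypothesis alpha_gt0 : 0 < alpha.

(** With gaps g_j 2^j, one minimizes the sum of g_j^(-alpha) 2^(j (d/2 - alpha)) for a given sum of
    the g_j. At the minimum g_j^(1 + alpha) is proportional to 2^(j (d/2 - alpha)), that is, g_j to
    [ratio]^j. *)
Definition ratio : R := 2 `^ ((d%:R / 2 - alpha) / (1 + alpha)).

Definition geo : R := \sum_(j < k.+1) ratio ^+ j.+1.

(* The total gap proportions [ratio ^ j / (2 d geo)] sum to [1 / (2 d)]; this
   choice minimizes the bound obtained below, by a Lagrange multiplier
   computation. *)
Definition spread (j : nat) : R := ratio ^+ j / (2 * d%:R * geo) * 2 ^+ j.

Definition total_gap (j : nat) : nat := if j is 0 then 0%N else Num.truncn (spread j).

Definition gap_incr (j : nat) : nat := (total_gap j.+1 - total_gap j)%N.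

Lemma alpha1_neq0 : 1 + alpha != 0.
Proof. by rewrite gt_eqF // addr_gt0. Qed.

Lemma ratio_gt0 : 0 < ratio. Proof. by rewrite powR_gt0. Qed.

Lemma ratio_powR : ratio `^ (1 + alpha) = 2 `^ (d%:R / 2 - alpha).
Proof. by rewrite -powRrM; congr (_ `^ _); field; exact: alpha1_neq0. Qed.

Lemma geo_gt0 : 0 < geo.
Proof.
rewrite /geo big_ord_recl; apply: ltr_pwDl; first exact: exprn_gt0 ratio_gt0.
by apply: sumr_ge0 => j _; rewrite exprn_ge0 // ltW // ratio_gt0.
Qed.

Lemma dR_gt0 : 0 < d%:R :> R. Proof. by rewrite ltr0n. Qed.

Lemma spread_gt0 j : 0 < spread j.
Proof.
by rewrite !mulr_gt0 ?invr_gt0 ?exprn_gt0 ?mulr_gt0 ?ratio_gt0 ?geo_gt0 ?dR_gt0.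
Qed.

(** Makes [spread] nondecreasing, so that the truncated subtraction in [gap_incr] is a true
    difference. *)
Lemma half_le_ratio : 1 <= ratio * 2.
Proof.
have -> : ratio * 2 = 2 `^ ((1 + d%:R / 2) / (1 + alpha)).
  rewrite -[X in _ * X = _]powRr1 // /ratio -powRD ?pnatr_eq0 ?implybT //.
  by congr (_ `^ _); field; exact: alpha1_neq0.
rewrite -[X in X <= _](powRr0 2); apply: ler_powR; first by lra.
by rewrite divr_ge0 ?addr_ge0 ?divr_ge0 ?ler0n // ltW.
Qed.

Lemma spread_le j : spread j <= spread j.+1.
Proof.
have -> : spread j.+1 = spread j * (ratio * 2) by rewrite /spread !exprS; ring.
by rewrite ler_peMr ?half_le_ratio // ltW // spread_gt0.
Qed.

Lemma total_gap_le j : (total_gap j <= total_gap j.+1)%N.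
Proof. by case: j => [//|j]; apply: le_truncn; exact: spread_le. Qed.

Lemma sum_gap_incr j : (\sum_(l < j) gap_incr l = total_gap j)%N.
Proof.
elim: j => [|j IH]; first by rewrite big_ord0.
by rewrite big_ord_recr /= IH /gap_incr subnKC // total_gap_le.
Qed.

(** The extra unit in [gap] makes up for the truncation in [total_gap]. *)
Lemma spread_lt_gap j : (0 < j)%N -> spread j < (gap gap_incr j)%:R.
Proof. by case: j => // j _; rewrite /gap sum_gap_incr truncnS_gt. Qed.

Lemma total_gap_le_spread j : (total_gap j)%:R <= spread j.
Proof.
case: j => [|j]; first exact/ltW/spread_gt0.
by rewrite truncn_le ltW // spread_gt0.
Qed.

Lemma period_le : (period gap_incr k)%:R <= 2 ^+ k * (1 + d%:R^-1) :> R.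
Proof.
rewrite /period /pos natrD natr_sum natrX mulrDr mulr1 lerD2l.
have -> : 2 ^+ k * d%:R^-1 = \sum_(j < k.+1) 2 ^+ k * (ratio ^+ j.+1 / (d%:R * geo)) :> R.
  rewrite -mulr_sumr -mulr_suml -/geo; congr (_ * _); field.
  by rewrite !gt_eqF ?geo_gt0 ?dR_gt0.
apply: ler_sum => j _; have jk : (j <= k)%N by rewrite -ltnS.
have -> : (2 ^ k %/ 2 ^ j)%N = (2 ^ (k - j))%N by rewrite -{1}(subnK jk) expnD mulnK ?expn_gt0.
(* The gaps that build up [spread j.+1], scaled by 2^(j+1), are inserted before multiples of 2^j:
   the proportion 1/(2d) becomes 1/d. *)
rewrite natrM natrX; apply: (@le_trans _ _ (spread j.+1 * 2 ^+ (k - j))).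
  rewrite ler_wpM2r ?exprn_ge0 //; apply: le_trans (total_gap_le_spread _).
  by rewrite ler_nat leq_subr.
rewrite le_eqVlt; apply/orP; left; apply/eqP.
have -> : 2 ^+ k = 2 ^+ (k - j) * 2 ^+ j :> R by rewrite -exprD subnK.
rewrite /spread !exprS.
by field; rewrite !gt_eqF ?geo_gt0 ?dR_gt0.
Qed.

Variables (phi : nat -> R) (c : R).
Hypothesis c_ge1 : 1 <= c.
Hypothesis phi0 : phi 0 = 1.
Hypothesis phi_le : forall r, (0 < r)%N -> phi r <= c * r%:R `^ (- alpha).

Lemma powR_natr (x : R) (j : nat) (y : R) : 0 <= x -> (x ^+ j) `^ y = (x `^ y) ^+ j.
Proof. by move=> x0; rewrite -(powR_mulrn j x0) -(powR_mulrn j (powR_ge0 x y)) powRAC. Qed.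

(** By the choice of [ratio], [spread j]^(-alpha) 2^(j d/2) collapses to a multiple of [ratio]^j:
    the costs of the levels form the same geometric series as the gap proportions. *)
Lemma phi_gap_le j : (0 < j)%N ->
  phi (gap gap_incr j) * (2 `^ (d%:R / 2)) ^+ j <=
  c * ((2 * d%:R * geo) `^ alpha * ratio ^+ j).
Proof.
move=> j0.
have g0 : (0 < gap gap_incr j)%N by case: j j0.
have D0 : 0 < 2 * d%:R * geo by rewrite !mulr_gt0 ?dR_gt0 ?geo_gt0.
have r0 := ratio_gt0; have s0 := spread_gt0 j.
have gs : (gap gap_incr j)%:R `^ (- alpha) <= spread j `^ (- alpha).
  rewrite !powRN lef_pV2 ?posrE ?powR_gt0 ?ltr0n //.
  by apply: ge0_ler_powR; rewrite ?nnegrE ?(ltW alpha_gt0) ?ler0n ?ltW // spread_lt_gap.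
have tw : 0 <= (2 `^ (d%:R / 2)) ^+ j :> R by rewrite exprn_ge0 // powR_ge0.
apply: le_trans (ler_wpM2r tw (phi_le g0)) _; rewrite -[X in X <= _]mulrA.
apply: ler_wpM2l; first exact: le_trans c_ge1.
apply: le_trans (ler_wpM2r tw gs) _; rewrite le_eqVlt; apply/orP; left; apply/eqP.
have -> : spread j = (ratio * 2) ^+ j * (2 * d%:R * geo)^-1.
  by rewrite /spread exprMn; ring.
rewrite powRM ?exprn_ge0 ?invr_ge0 ?mulr_ge0 ?(ltW r0) ?(ltW D0) //.
rewrite powR_natr ?mulr_ge0 ?(ltW r0) //.
have -> : ((2 * d%:R * geo)^-1) `^ (- alpha) = (2 * d%:R * geo) `^ alpha.
  by rewrite -(powR_inv1 (ltW D0)) -powRrM mulrNN mul1r.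
rewrite mulrAC -exprMn mulrC; congr (_ * _ ^+ _).
rewrite powRM ?(ltW r0) // -mulrA -powRD ?pnatr_eq0 ?implybT // addrC -ratio_powR.
rewrite -powRD ?(gt_eqF r0) ?implybT //.
have -> : - alpha + (1 + alpha) = 1 by ring.
by rewrite powRr1 // ltW.
exact: ltW geo_gt0.
Qed.

Lemma sqrt_card j n : Num.sqrt ((2 ^ j) ^ d * n ^ d)%:R =
  (2 `^ (d%:R / 2)) ^+ j * Num.sqrt (n ^ d)%:R :> R.
Proof.
rewrite natrM sqrtrM ?ler0n //; congr (_ * _).
rewrite -powR12_sqrt ?ler0n // !natrX -exprM mulnC exprM powR_natr ?exprn_ge0 //.
by congr (_ ^+ _); rewrite -powR_mulrn // -powRrM.
Qed.

Lemma sum_phi_gap :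
  \sum_(j < k.+2) phi (gap gap_incr j) * (2 `^ (d%:R / 2)) ^+ j <=
  c * (1 + (2 * d%:R) `^ alpha * geo `^ (1 + alpha)).
Proof.
(* Level 0 has no gap and contributes [phi 0], that is 1, which is at most [c]. *)
rewrite big_ord_recl /= phi0 mulr1 mulrDr; apply: lerD; first by rewrite mulr1.
have -> : (2 * d%:R) `^ alpha * geo `^ (1 + alpha) =
    \sum_(j < k.+1) (2 * d%:R * geo) `^ alpha * ratio ^+ j.+1.
  rewrite -mulr_sumr -/geo [in RHS]powRM ?mulr_ge0 ?ler0n ?(ltW geo_gt0) //.
  rewrite powRD ?powRr1 ?(ltW geo_gt0) ?(gt_eqF geo_gt0) ?implybT //; ring.
by rewrite mulr_sumr; apply: ler_sum => j _; exact: (phi_gap_le (ltn0Sn j)).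
Qed.

Lemma scale_bound (n : nat) (kap M : R) : (0 < n)%N -> 0 <= kap -> 0 <= M ->
  ((n ^ d)%:R * ((2 ^ k) ^ d)%:R)^-1 * ((period gap_incr k ^ d)%:R *
    level_sum d n k kap (fun j => M * phi (gap gap_incr j))) <=
  2 * (1 + d%:R^-1) ^+ d * (Num.sqrt kap * M * c * (n ^ d)%:R `^ (- (1 / 2)) *
    (1 + (2 * d%:R) `^ alpha * geo `^ (1 + alpha))).
Proof.
move=> n0 kap0 M0; set N : R := (n ^ d)%:R.
have N0 : 0 < N by rewrite ltr0n expn_gt0 n0.
have lev : level_sum d n k kap (fun j => M * phi (gap gap_incr j)) <=
    2 * Num.sqrt kap * M * Num.sqrt N * (c * (1 + (2 * d%:R) `^ alpha * geo `^ (1 + alpha))).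
  apply: le_trans (ler_wpM2l _ sum_phi_gap).
    rewrite /level_sum mulr_sumr le_eqVlt; apply/orP; left; apply/eqP.
    by apply: eq_bigr => j _; rewrite sqrt_card -/N; ring.
  by rewrite !mulr_ge0 ?sqrtr_ge0.
have per : (period gap_incr k ^ d)%:R <= ((2 ^ k) ^ d)%:R * (1 + d%:R^-1) ^+ d :> R.
  rewrite !natrX -exprMn; apply: lerXn2r; rewrite ?nnegrE ?ler0n ?period_le //.
have sN : N^-1 * Num.sqrt N = N `^ (- (1 / 2)).
  rewrite -powR12_sqrt ?(ltW N0) // -(powR_inv1 (ltW N0)) -powRD ?(gt_eqF N0) ?implybT //.
  by congr (_ `^ _); field.
have B0 : 0 < ((2 ^ k) ^ d)%:R :> R by rewrite ltr0n !expn_gt0.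
have H0 : 0 <= c * (1 + (2 * d%:R) `^ alpha * geo `^ (1 + alpha)).
  by rewrite mulr_ge0 ?(le_trans _ c_ge1) // addr_ge0 // mulr_ge0 // powR_ge0.
have P0 : 0 <= (period gap_incr k ^ d)%:R :> R := ler0n _ _.
rewrite -sN; move: lev per B0 P0; move: (level_sum _ _ _ _ _) => lev.
move: ((period _ _ ^ d)%:R) (((2 ^ k) ^ d)%:R) H0 => per B.
set H := 1 + _ => H0 levH perB B0 P0.
have E0 : 0 <= (1 + d%:R^-1) ^+ d :> R.
  by rewrite exprn_ge0 // addr_ge0 // invr_ge0 ler0n.
apply: (@le_trans _ _ ((N * B)^-1 *
    (B * (1 + d%:R^-1) ^+ d * (2 * Num.sqrt kap * M * Num.sqrt N * (c * H))))).
  apply: ler_wpM2l; first by rewrite invr_ge0 mulr_ge0 // ltW.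
  apply: (@le_trans _ _ (per * (2 * Num.sqrt kap * M * Num.sqrt N * (c * H)))).
    by apply: ler_wpM2l.
  apply: ler_wpM2r => //; apply: mulr_ge0 => //.
  by rewrite !mulr_ge0 ?sqrtr_ge0.
rewrite le_eqVlt; apply/orP; left; apply/eqP; field.
by rewrite !gt_eqF.
Qed.

(** * Comparison with the stated constants *)

Lemma geoM1 : geo * (1 - ratio) = ratio * (1 - ratio ^+ k.+1).
Proof.
rewrite /geo; elim: k => [|m IH]; first by rewrite big_ord1 !expr1; ring.
by rewrite big_ord_recr /= mulrDl IH (exprS _ m.+1); ring.
Qed.

Lemma expR1_le4 : expR 1 <= 4 :> R.
Proof.
have e : expR (2^-1) <= 2 :> R.
  have := @expR_ge1Dx R (- 2^-1); rewrite expRN => h.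
  rewrite -[X in _ <= X]invrK -[X in X <= _]invrK lef_pV2 ?posrE ?invr_gt0 ?expR_gt0 //.
  by apply: le_trans h; lra.
have -> : 1 = 2^-1 + 2^-1 :> R by field.
by rewrite expRD; have := expR_gt0 (2^-1 : R); nra.
Qed.

(** The lengthening by 1 + 1/d on each of the d axes costs at most e in total: this is why the gap
    proportion is of order 1/d. *)
Lemma pow_le4 : (1 + d%:R^-1) ^+ d <= 4 :> R.
Proof.
apply: le_trans expR1_le4.
have -> : 1 = d%:R * d%:R^-1 :> R by rewrite divff ?gt_eqF ?dR_gt0.
rewrite expRM_natl; apply: lerXn2r; rewrite ?nnegrE ?expR_ge0 //; last first.
  by rewrite divff ?gt_eqF ?dR_gt0 // expR_ge1Dx.
Qed.

Let Q : R := `|1 - ratio| `^ (- (1 + alpha)).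
Let Z : R := 2 `^ alpha * d%:R `^ (2 * alpha).

Lemma Z_ge : (2 * d%:R) `^ alpha <= Z.
Proof.
rewrite powRM ?ler0n //; apply: ler_wpM2l; first exact: powR_ge0.
by apply: ler_powR; rewrite ?ler1n //; have := alpha_gt0; lra.
Qed.

Lemma Z_ge1 : 1 <= Z.
Proof.
apply: le_trans Z_ge; rewrite -[X in X <= _](powRr0 (2 * d%:R)); apply: ler_powR; last exact: ltW.
by rewrite -natrM ler1n muln_gt0.
Qed.

Lemma C_polyE : C_poly d alpha = 24 * 2 ^+ d * (Z * Q).
Proof.
rewrite /C_poly -/ratio -/Q powRD ?pnatr_eq0 ?implybT // powR_mulrn // /Z.
by rewrite !mulrA.
Qed.

Lemma ln2_gt0 : 0 < ln 2 :> R.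
Proof. by rewrite ln_gt0 // ltr1n. Qed.

(** Here [ratio] < 1, and [geo] is at most 1 / (1 - ratio) whatever [k]; this is the origin of
    [Q]. *)
Lemma poly_bound_gt : d%:R / 2 < alpha ->
  2 * (1 + d%:R^-1) ^+ d * (1 + (2 * d%:R) `^ alpha * geo `^ (1 + alpha)) <=
  C_poly d alpha.
Proof.
move=> da; have r0 := ratio_gt0; have g0 := geo_gt0.
have a1 : 0 < 1 + alpha by rewrite addr_gt0.
have r1 : ratio < 1.
  rewrite -ltr_ln ?posrE // ln1 ln_powR pmulr_llt0 ?ln2_gt0 //.
  by rewrite pmulr_llt0 ?invr_gt0 // subr_lt0.
have r1' : 0 < 1 - ratio by rewrite subr_gt0.
have gQ : geo `^ (1 + alpha) <= Q.
  rewrite /Q gtr0_norm // powRN -powR_inv1 ?powR_ge0 // -powRrM mulrN1.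
  rewrite -[- (1 + alpha)]mulN1r powRrM powR_inv1 ?(ltW r1') //.
  apply: ge0_ler_powR; rewrite ?nnegrE ?(ltW a1) ?(ltW g0) ?invr_ge0 ?(ltW r1') //.
  rewrite -[X in _ <= X]mul1r ler_pdivlMr // geoM1.
  by rewrite mulr_ile1 ?(ltW r0) ?subr_ge0 ?exprn_ile1 ?(ltW r0) ?(ltW r1) //
    lerBlDr lerDl exprn_ge0 // ltW.
have Q1 : 1 <= Q.
  rewrite /Q gtr0_norm // powRN -[X in X <= _]invr1 lef_pV2 ?posrE ?powR_gt0 //.
  have e1 : 1 = 1 `^ (1 + alpha) :> R by rewrite powR1.
  rewrite [X in _ <= X]e1.
  by apply: ge0_ler_powR; rewrite ?nnegrE ?(ltW a1) ?(ltW r1') // lerBlDr lerDl ltW.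
rewrite C_polyE; have := pow_le4; have Z1 := Z_ge1.
have ZQ : (2 * d%:R) `^ alpha * geo `^ (1 + alpha) <= Z * Q.
  by apply: ler_pM; rewrite ?powR_ge0 // Z_ge.
have ZQ1 : 1 <= Z * Q by apply: mulr_ege1.
have D1 : 1 <= 2 ^+ d :> R by rewrite exprn_ege1 // ler1n.
have y0 : 0 <= (2 * d%:R) `^ alpha * geo `^ (1 + alpha) by rewrite mulr_ge0 ?powR_ge0.
have E0 : 0 <= (1 + d%:R^-1) ^+ d :> R by rewrite exprn_ge0 // addr_ge0 // invr_ge0.
move: ZQ y0 E0.
move: (Z * Q) ZQ1 (_ * geo `^ _) (2 ^+ d) D1 (_ ^+ d).
move=> zq zq1 y D D1 E yzq y0 E0 E4.
have : E * (1 + y) <= 4 * (1 + zq) by apply: ler_pM; lra.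
nra.
Qed.

(** Here [ratio] > 1 and [geo] is at most ratio^(k+2) / (ratio - 1). Raised to the power 1 + alpha,
    ratio^k becomes (2^k)^(d/2 - alpha), at most N^(1/2 - alpha/d); the two other factors are
    absorbed by 2^d. *)
Lemma poly_bound_lt (n : nat) : (0 < n)%N -> (2 ^ k <= n)%N -> alpha < d%:R / 2 ->
  2 * (1 + d%:R^-1) ^+ d * (1 + (2 * d%:R) `^ alpha * geo `^ (1 + alpha)) <=
  C_poly d alpha * (n ^ d)%:R `^ (1 / 2 - alpha / d%:R).
Proof.
move=> n0 kn da; have r0 := ratio_gt0; have g0 := geo_gt0.
have a1 : 0 < 1 + alpha by rewrite addr_gt0.
have n1 : 1 <= n%:R :> R by rewrite ler1n.
have r1 : 1 < ratio.
  rewrite -ltr_ln ?posrE // ln1 ln_powR mulr_gt0 ?ln2_gt0 //.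
  by rewrite mulr_gt0 ?invr_gt0 // subr_gt0.
have r1' : 0 < ratio - 1 by rewrite subr_gt0.
have Q0 : 0 < Q.
  by rewrite /Q powR_gt0 // normr_gt0 subr_eq0 lt_eqF.
have QE : Q = (ratio - 1)^-1 `^ (1 + alpha).
  rewrite /Q distrC gtr0_norm // -[(ratio - 1)^-1](powR_inv1 (ltW r1')) -powRrM.
  by rewrite mulN1r.
set B := 2 `^ (d%:R / 2 - alpha).
have B0 : 0 < B by rewrite powR_gt0.
set Y := (n ^ d)%:R `^ (1 / 2 - alpha / d%:R).
have YE : Y = n%:R `^ (d%:R / 2 - alpha).
  rewrite /Y natrX -powR_mulrn ?ler0n // -powRrM; congr (_ `^ _); field.
  by rewrite gt_eqF ?dR_gt0.
have Y1 : 1 <= Y.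
  rewrite YE -[X in X <= _](powRr0 n%:R); apply: ler_powR => //.
  by rewrite subr_ge0 ltW.
have gQ : geo `^ (1 + alpha) <= Y * B ^+ 2 * Q.
  apply: (@le_trans _ _ ((ratio ^+ k.+2 / (ratio - 1)) `^ (1 + alpha))).
    apply: ge0_ler_powR; rewrite ?nnegrE ?(ltW a1) ?(ltW g0) //.
      by rewrite divr_ge0 ?exprn_ge0 // ltW.
    rewrite ler_pdivlMr // -opprB mulrN geoM1 (exprS _ k.+1) -mulrN opprB.
    by rewrite ler_pM2l // lerBlDr lerDl.
  rewrite powRM ?exprn_ge0 ?invr_ge0 ?(ltW r0) ?(ltW r1') // -QE.
  apply: ler_wpM2r; first exact: ltW.
  rewrite powR_natr ?(ltW r0) // ratio_powR -/B -addn2 exprD.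
  apply: ler_wpM2r; first exact: sqr_ge0.
  rewrite YE -powR_natr // -natrX; apply: ge0_ler_powR; rewrite ?nnegrE ?ler0n ?ler_nat //.
  by rewrite subr_ge0 ltW.
have BB : B ^+ 2 <= 2 ^+ d.
  rewrite -powR_mulrn ?(ltW B0) // -powRrM -powR_mulrn //; apply: ler_powR.
    by rewrite ler1n.
  by have := alpha_gt0; lra.
(* [Q] is small when [ratio] is large; the factor 2^d of [C_poly] still covers the summand 1. *)
have QB : 1 <= 2 ^+ d * Q.
  have BQ : 1 <= B * Q.
    rewrite QE -[ratio - 1]invrK.
    have -> : B = ratio `^ (1 + alpha) by rewrite ratio_powR.
    rewrite invrK -powRM ?invr_ge0 ?(ltW r0) ?(ltW r1') //.
    have e1 : 1 = 1 `^ (1 + alpha) :> R by rewrite powR1.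
    rewrite [X in X <= _]e1; apply: ge0_ler_powR; rewrite ?nnegrE ?(ltW a1) //.
      by rewrite divr_ge0 // ltW.
    by rewrite ler_pdivlMr // mul1r lerBlDr lerDl.
  apply: le_trans BQ _; apply: ler_wpM2r; first exact: ltW.
  rewrite -powR_mulrn //; apply: ler_powR; first by rewrite ler1n.
  by have := alpha_gt0; have := dR_gt0; lra.
have Z1 := Z_ge1; have := pow_le4; rewrite C_polyE.
have D0 : 0 < 2 ^+ d :> R by rewrite exprn_gt0.
have y0 : 0 <= (2 * d%:R) `^ alpha * geo `^ (1 + alpha) by rewrite mulr_ge0 ?powR_ge0.
have E0 : 0 <= (1 + d%:R^-1) ^+ d :> R by rewrite exprn_ge0 // addr_ge0 // invr_ge0.
have ZY1 : 1 <= Z * Y by apply: mulr_ege1.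
have T1 : 1 <= 2 ^+ d * (Z * Q) * Y.
  have -> : 2 ^+ d * (Z * Q) * Y = (2 ^+ d * Q) * (Z * Y) by ring.
  exact: mulr_ege1.
have yT : (2 * d%:R) `^ alpha * geo `^ (1 + alpha) <= 2 ^+ d * (Z * Q) * Y.
  have -> : 2 ^+ d * (Z * Q) * Y = Z * (Y * 2 ^+ d * Q) by ring.
  apply: ler_pM; rewrite ?powR_ge0 ?Z_ge //; apply: le_trans gQ _.
  apply: ler_wpM2r; first exact: ltW.
  by apply: ler_wpM2l => //; exact: le_trans Y1.
rewrite -[24 * _ * _]mulrA -[24 * _ * _]mulrA; move: y0 E0 yT T1.
move: (_ * geo `^ _) (2 ^+ d * (Z * Q) * Y) ((1 + _) ^+ d).
move=> y T E y0 E0 yT T1 E4.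
have : E * (1 + y) <= 4 * (1 + T) by apply: ler_pM; lra.
lra.
Qed.

(** Here [ratio] = 1 and [geo] = k + 1 is at most 2 log2 n; its power 1 + d/2 becomes that of the
    logarithm. *)
Lemma crit_bound (n : nat) : (2 <= n)%N -> (2 ^ k <= n)%N -> alpha = d%:R / 2 ->
  2 * (1 + d%:R^-1) ^+ d * (1 + (2 * d%:R) `^ alpha * geo `^ (1 + alpha)) <=
  C_crit d * log2 (n ^ d)%:R `^ (d%:R / 2 + 1).
Proof.
move=> n2 kn ad; have d0 := dR_gt0.
have n0 : 0 < n%:R :> R by rewrite ltr0n (leq_trans _ n2).
have g0 : geo = k.+1%:R.
  rewrite /geo /ratio ad subrr mul0r powRr0.
  by rewrite (eq_bigr (fun=> 1)) ?sumr_const ?card_ord // => i _; rewrite expr1n.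
pose l := ln n%:R / ln 2 : R.
have l1 : 1 <= l.
  by rewrite ler_pdivlMr ?ln2_gt0 // mul1r ler_ln ?posrE // ler_nat.
have kl : k%:R <= l.
  rewrite ler_pdivlMr ?ln2_gt0 // -ln_powR powR_mulrn // -natrX.
  by rewrite ler_ln ?posrE ?ler_nat // ltr0n expn_gt0.
have gl : geo <= 2 * l by rewrite g0 -natr1; lra.
have lE : log2 (n ^ d)%:R = d%:R * l :> R.
  by rewrite /log2 natrX -powR_mulrn ?(ltW n0) // ln_powR mulrA.
set u := (2 * d%:R) `^ (d%:R / 2) : R; set v := 2 `^ (d%:R / 2) : R.
set D := d%:R `^ (d%:R / 2 + 1) : R; set L := l `^ (d%:R / 2 + 1).
have e0 : 0 <= d%:R / 2 + 1 :> R by rewrite addr_ge0 // divr_ge0.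
have d1 : 1 <= d%:R :> R by rewrite ler1n.
have one_le (x y : R) : 1 <= x -> 0 <= y -> 1 <= x `^ y.
  by move=> x1 y0; rewrite -[X in X <= _](powRr0 x); apply: ler_powR.
have L1 : 1 <= L by exact: one_le.
have D1 : 1 <= D by exact: one_le.
have v1 : 1 <= v by apply: one_le; rewrite ?ler1n // divr_ge0.
have v0 : 0 <= v by exact: le_trans v1.
have uv : v <= u.
  apply: ge0_ler_powR; rewrite ?nnegrE ?divr_ge0 ?mulr_ge0 //.
  by lra.
have vv : 2 <= v * v.
  rewrite -powRD ?pnatr_eq0 ?implybT //.
  have -> : d%:R / 2 + d%:R / 2 = d%:R :> R by field.
  by rewrite -[X in X <= _]powRr1 //; apply: ler_powR; rewrite ?ler1n.
have gL : geo `^ (1 + alpha) <= 2 * v * L.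
  apply: (@le_trans _ _ ((2 * l) `^ (d%:R / 2 + 1))).
    rewrite ad addrC; apply: ge0_ler_powR; rewrite ?nnegrE ?(ltW geo_gt0) //.
    by rewrite mulr_ge0 // (le_trans _ l1).
  rewrite powRM ?(le_trans _ l1) // powRD ?pnatr_eq0 ?implybT // powRr1 //.
  by rewrite (mulrC 2).
have CE : C_crit d * log2 (n ^ d)%:R `^ (d%:R / 2 + 1) = 15 * (u * (v * v)) * (D * L).
  rewrite lE powRM ?(le_trans _ l1) // -/D -/L /C_crit; congr (_ * _ * _).
  have -> : 8 * d%:R = 2 * d%:R * 2 * 2 :> R by ring.
  by rewrite powRM ?mulr_ge0 // powRM ?mulr_ge0 // -/u -/v mulrA.
rewrite CE ad -/u.
have yb : u * geo `^ (1 + d%:R / 2) <= u * (2 * v * L).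
  by apply: ler_wpM2l; rewrite ?powR_ge0 // -ad.
have E0 : 0 <= (1 + d%:R^-1) ^+ d :> R by rewrite exprn_ge0 // addr_ge0 // invr_ge0.
(* For d >= 2 the bound 4 is paid for by v >= 2; for d = 1 the power on the left is exactly 2. *)
have EvD : 5 * (1 + d%:R^-1) ^+ d <= 15 * v * D.
  case: (ltngtP d 1%N) => [|dgt1|d_eq1]; first by rewrite ltnNge d_gt0.
    have v2 : 2 <= v.
      rewrite -[X in X <= _]powRr1 //; apply: ler_powR; first by rewrite ler1n.
      by rewrite ler_pdivlMr // mul1r ler_nat.
    have := pow_le4; nra.
  by rewrite d_eq1 invr1 expr1 in E0 *; nra.
move: EvD E0 yb; move: ((1 + d%:R^-1) ^+ d) (geo `^ _) => E y EvD E0 yb.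
have uvL : 2 <= u * v * L.
  have : 2 * 1 <= (u * v) * L by apply: ler_pM => //; nra.
  by rewrite mulr1.
have : E * (1 + u * y) <= E * (5 / 2 * (u * v * L)).
  apply: ler_wpM2l => //; lra.
have : (5 * E) * (u * v * L) <= (15 * v * D) * (u * v * L).
  by apply: ler_wpM2r => //; lra.
clearbody u v D L; move=> h1 h2; lra.
Qed.

End GapChoice.

Lemma rate_bounds (R : realType) (d n : nat) (alpha c : R) (phi : nat -> R) :
  (0 < d)%N -> (2 <= n)%N -> 0 < alpha -> 1 <= c -> phi 0%N = 1 ->
  (forall r, (0 < r)%N -> phi r <= c * r%:R `^ (- alpha)) ->
  let N : R := (n ^ d)%:R in
  exists k h, (n <= 2 ^ k.+1)%N /\
    forall kap M : R, 0 <= kap -> 0 <= M ->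
    let bound := (N * ((2 ^ k) ^ d)%:R)^-1 *
      ((period h k ^ d)%:R * level_sum d n k kap (fun j => M * phi (gap h j))) in
    (alpha <> d%:R / 2 -> bound <= c * C_poly d alpha * Num.sqrt kap * M *
       N `^ (- Num.min (1 / 2) (alpha / d%:R))) /\
    (alpha = d%:R / 2 -> bound <= c * C_crit d * Num.sqrt kap * M *
       N `^ (- (1 / 2)) * log2 N `^ (d%:R / 2 + 1)).
Proof.
move=> d0 n2 a0 c1 phi0 phi_le N.
(* Then 2^k <= n <= 2^(k+1): the upper bound serves the top block, the lower one turns powers of 2^k
   into powers of n. *)
pose k := trunc_log 2 n.-1; pose h := @gap_incr R d k alpha.
have n1 : (0 < n.-1)%N by rewrite -ltnS prednK // ltnW.
have n0 : (0 < n)%N by rewrite ltnW.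
have /andP[kn nk] : (2 ^ k <= n.-1 < 2 ^ k.+1)%N := @trunc_log_bounds 2 n.-1 isT n1.
have {}kn : (2 ^ k <= n)%N by apply: leq_trans kn (leq_pred n).
exists k, h; split; first by rewrite -(prednK n0).
move=> kap M kap0 M0 bound.
have dR : 0 < d%:R :> R by rewrite ltr0n.
have N0 : 0 < N by rewrite ltr0n expn_gt0 n0.
set S := Num.sqrt kap * M * c.
have S0 : 0 <= S by rewrite !mulr_ge0 ?sqrtr_ge0 // (le_trans _ c1).
have := scale_bound k d0 a0 c1 phi0 phi_le n0 kap0 M0; rewrite -/N -/bound -/S.
move: bound => bound.
set E := 2 * _; set F := 1 + _ => bd.
have {}bd : bound <= S * N `^ (- (1 / 2)) * (E * F).
  by apply: le_trans bd _; rewrite le_eqVlt; apply/orP; left; apply/eqP; ring.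
have SN0 : 0 <= S * N `^ (- (1 / 2)) by rewrite mulr_ge0 ?powR_ge0.
split=> [/eqP ane|ae].
- have -> : c * C_poly d alpha * Num.sqrt kap * M * N `^ (- Num.min (1 / 2) (alpha / d%:R)) =
      S * (C_poly d alpha * N `^ (- Num.min (1 / 2) (alpha / d%:R))) by rewrite /S; ring.
  have [ad|da|ad] := ltgtP alpha (d%:R / 2); last by rewrite ad eqxx in ane.
  + have -> : Num.min (1 / 2) (alpha / d%:R) = alpha / d%:R.
      by apply: min_r; rewrite ler_pdivrMr //; lra.
    apply: le_trans bd _.
    have -> : N `^ (- (alpha / d%:R)) = N `^ (- (1 / 2)) * N `^ (1 / 2 - alpha / d%:R).
      rewrite -powRD ?(gt_eqF N0) ?implybT //; congr (_ `^ _); ring.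
    rewrite -[X in X <= _]mulrA; apply: ler_wpM2l => //.
    rewrite [X in _ <= X]mulrCA; apply: ler_wpM2l; first exact: powR_ge0.
    exact: poly_bound_lt.
  + have -> : Num.min (1 / 2) (alpha / d%:R) = 1 / 2.
      by apply: min_l; rewrite ler_pdivlMr //; lra.
    apply: le_trans bd _; rewrite -[X in X <= _]mulrA; apply: ler_wpM2l => //.
    rewrite [X in _ <= X]mulrC; apply: ler_wpM2l; first exact: powR_ge0.
    exact: poly_bound_gt.
- have -> : c * C_crit d * Num.sqrt kap * M * N `^ (- (1 / 2)) * log2 N `^ (d%:R / 2 + 1) =
      S * N `^ (- (1 / 2)) * (C_crit d * log2 N `^ (d%:R / 2 + 1)) by rewrite /S; ring.
  apply: le_trans bd _; apply: ler_wpM2l => //.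
  exact: crit_bound.
Qed.

(** * Discretization *)

(** Conditional Jensen inequality: the slope of the tangent at [cexp w U y] depends on [U] only, so
    the linear term averages to zero. *)
Lemma Lp_le_cexp (R : realType) (I V : finType) (w : {ffun I -> V} -> R) (p : R)
    (U : {set I}) y a : (forall o, 0 <= w o) -> 1 < p ->
  Lp_le w p y a -> Lp_le w p (cexp w U y) a.
Proof.
move=> w0 p1 [a0 ya]; split=> //; apply: le_trans ya.
pose g z : R := p * `|z| `^ (p - 2) * z.
have gU : depends U (fun o => g (cexp w U y o)).
  by move=> o o' oo'; rewrite (cexp_depends w y oo').
have orth : wmean w (fun o => g (cexp w U y o) * (y o - cexp w U y o)) = 0.
  rewrite (eq_wmean w (g := fun o => g (cexp w U y o) * y o +
    -1 * (g (cexp w U y o) * cexp w U y o))); last by move=> o; ring.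
  by rewrite wmeanD wmeanZ (wmean_cexp w0 y gU) mulN1r subrr.
apply: (@le_trans _ _ (wmean w (fun o => `|cexp w U y o| `^ p +
    g (cexp w U y o) * (y o - cexp w U y o)))).
  by rewrite wmeanD orth addr0.
by apply: wmean_le => // o; exact: powR_tangent.
Qed.

Lemma wsup_le_cexp (R : realType) (I V : finType) (w : {ffun I -> V} -> R)
    (U : {set I}) y a : (forall o, 0 <= w o) -> wsup_le w y a -> wsup_le w (cexp w U y) a.
Proof.
move=> w0 [a0 ya]; split=> // o wo; rewrite /cexp.
have W0 : 0 < \sum_(o' | agree U o o') w o'.
  by rewrite (bigD1 o) ?agree_refl //= ltr_pwDl // sumr_ge0.
rewrite normrM normfV (gtr0_norm W0) ler_pdivrMr // mulr_sumr.
apply: le_trans (ler_norm_sum _ _ _) _; apply: ler_sum => o' _.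
rewrite normrM (ger0_norm (w0 o')).
have [wo'|wo'] := ltP 0 (w o'); first by rewrite mulrC ler_wpM2r // ya.
have -> : w o' = 0 by apply: le_anti; rewrite wo' w0.
by rewrite mul0r mulr0.
Qed.

(** * Averages over a finite partition *)

Section FinitePartition.
Context {R : realType} {disp : measure_display} {T : measurableType disp}.
Variable P : probability T R.
Context {Om : finType}.
Variable v : T -> Om.
Hypothesis mv : forall o, measurable (v @^-1` [set o]).

Definition wt (o : Om) : R := fine (P (v @^-1` [set o])).

Definition avg (f : T -> R) (o : Om) : R :=
  (\int[P]_(x in v @^-1` [set o]) f x) / wt o.

Definition part (B : pred Om) : set T := [set x | B (v x)].

Lemma partE B : part B = \big[setU/set0]_(o <- enum B) (v @^-1` [set o]).
Proof.
rewrite -bigcup_seq; apply/seteqP; split => x /=.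
  by move=> Bx; exists (v x) => //=; rewrite mem_enum.
by case=> o; rewrite /= mem_enum => Bo xo; rewrite /part /= xo.
Qed.

Lemma measurable_part B : measurable (part B).
Proof. by rewrite partE; apply: bigsetU_measurable. Qed.

Lemma partT : part predT = setT.
Proof. by apply/seteqP; split. Qed.

Lemma trivIset_atoms (D : set Om) : trivIset D (fun o => v @^-1` [set o]).
Proof. by move=> o o' _ _ [x [/= <- <-]]. Qed.

Lemma wt_ge0 o : 0 <= wt o.
Proof. exact: fine_ge0. Qed.

Lemma EFin_wt o : (wt o)%:E = P (v @^-1` [set o]).
Proof. by rewrite fineK // fin_num_measure. Qed.

Lemma Rintegral_part f B : P.-integrable setT (EFin \o f) ->
  \sum_(o | B o) \int[P]_(x in v @^-1` [set o]) f x = \int[P]_(x in part B) f x.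
Proof.
move=> intf; have mB := measurable_part B.
rewrite /Rintegral partE integral_bigsetU_EFin ?enum_uniq //; last first.
- rewrite -partE; apply: measurable_funS (measurable_int _ intf) => //.
- exact: trivIset_atoms.
rewrite -sum_fine ?big_enum // => o _.
apply: integrable_fin_num => //; apply: integrableS intf => //.
Qed.

Lemma measurable_fun_atoms (f : Om -> R) : measurable_fun setT (fun x => f (v x)).
Proof.
move=> _ Y mY; rewrite setTI.
have -> : (fun x => f (v x)) @^-1` Y = part (fun o => `[< Y (f o) >]).
  by apply/seteqP; split => x /=; rewrite /part /= => /asboolP.
exact: measurable_part.
Qed.

Lemma ge0_integral_part (f : Om -> R) B : (forall o, 0 <= f o) ->
  (\int[P]_(x in part B) (f (v x))%:E = (\sum_(o | B o) wt o * f o)%:E)%E.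
Proof.
move=> f0.
have mf := measurable_fun_atoms f.
rewrite partE ge0_integral_bigsetU ?enum_uniq //.
- rewrite big_enum -sumEFin; apply: eq_bigr => o _.
  rewrite (eq_integral (fun=> (f o)%:E)); last by move=> x; rewrite inE /= => ->.
  by rewrite integral_cst // EFinM EFin_wt muleC.
- exact: trivIset_atoms.
- by apply/measurable_EFinP; exact: measurable_funTS mf.
- by move=> x _; rewrite lee_fin.
Qed.

Lemma sum_wt B : \sum_(o | B o) wt o = fine (P (part B)).
Proof.
have := @ge0_integral_part (fun=> 1) B (fun=> ler01).
rewrite integral_cst ?mul1e; last exact: measurable_part.
by move=> ->; rewrite /=; apply: eq_bigr => o _; rewrite mulr1.
Qed.

Lemma wt_sum1 : \sum_o wt o = 1.
Proof. by rewrite sum_wt partT probability_setT. Qed.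

(** On a null atom [avg] is 0 by the convention on division, and the integral vanishes too. *)
Lemma wt_avg f o : P.-integrable setT (EFin \o f) ->
  wt o * avg f o = \int[P]_(x in v @^-1` [set o]) f x.
Proof.
move=> intf; rewrite /avg; have [w0|w0] := eqVneq (wt o) 0; last by rewrite mulrCA divff ?mulr1.
have P0 : P (v @^-1` [set o]) = 0%E by rewrite -EFin_wt w0.
rewrite w0 mul0r /Rintegral null_set_integral //.
by apply: (@measurable_funTS _ _ _ _ _ (EFin \o f)); exact: measurable_int intf.
Qed.

Lemma sum_wt_avg f B : P.-integrable setT (EFin \o f) ->
  \sum_(o | B o) wt o * avg f o = \int[P]_(x in part B) f x.
Proof.
by move=> intf; rewrite -Rintegral_part //; apply: eq_bigr => o _; exact: wt_avg.
Qed.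

Lemma wsup_le_avg f a : P.-integrable setT (EFin \o f) -> 0 <= a ->
  {ae P, forall x, `|f x| <= a} -> wsup_le wt (avg f) a.
Proof.
move=> intf a0 fa; split=> // o w0.
rewrite normrM normfV (gtr0_norm w0) ler_pdivrMr //.
have intA : P.-integrable (v @^-1` [set o]) (EFin \o f) by exact: (integrableS measurableT (mv o) (@subsetT _ _) intf).
apply: le_trans (le_normr_Rintegral _ intA) _ => //.
rewrite -lee_fin EFinM EFin_wt -integral_cst // /Rintegral fineK; last first.
  apply: integrable_fin_num => //.
  by have := integrable_abse intA.
apply: ae_ge0_le_integral => //.
  by apply/measurable_EFinP/measurableT_comp => //; apply/measurable_EFinP/(measurable_int P).
by apply: filterS fa => x fx _; rewrite lee_fin.
Qed.

(** Jensen's inequality on each atom, by integrating the tangent at the average [c]. *)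
Lemma Lp_le_avg f p a : 1 < p -> 0 <= a -> P.-integrable setT (EFin \o f) ->
  (\int[P]_x (`|f x| `^ p)%:E <= (a `^ p)%:E)%E -> Lp_le wt p (avg f) a.
Proof.
move=> p1 a0 intf fa; split=> //.
have mf : measurable_fun setT f by apply/measurable_EFinP; exact: measurable_int intf.
have mfp : measurable_fun setT (fun x => `|f x| `^ p).
  apply: (measurableT_comp (measurable_powR p)); exact: measurableT_comp.
have intfp : P.-integrable setT (EFin \o (fun x => `|f x| `^ p)).
  apply/integrableP; split; first exact/measurable_EFinP.
  under eq_integral do rewrite /= ger0_norm ?powR_ge0 //.
  exact: le_lt_trans fa (ltry _).
apply: (@le_trans _ _ (\int[P]_x (`|f x| `^ p))); last first.
  by rewrite -lee_fin fineK // integrable_fin_num.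
have := Rintegral_part predT intfp; rewrite partT => <-; apply: ler_sum => o _.
set c := avg f o; set A := v @^-1` [set o].
have intA : P.-integrable A (EFin \o f) by exact: (integrableS measurableT (mv o) (@subsetT _ _) intf).
have intcst k : P.-integrable A (EFin \o cst k).
  exact: finite_measure_integrable_cst (mv o).
pose K := p * `|c| `^ (p - 2) * c.
have intfc : P.-integrable A (EFin \o (fun x => f x + - c)).
  exact: (integrableD (mv o) intA (intcst (- c))).
have intK : P.-integrable A (EFin \o (fun x => K * (f x + - c))).
  exact: (integrableZl (mv o) K intfc).
have -> : wt o * `|c| `^ p = \int[P]_(x in A) (`|c| `^ p + K * (f x + - c)).
  have mA : measurable A by exact: mv.
  have e1 := RintegralD mA (intcst (`|c| `^ p)) intK.
  have e2 := RintegralZl K mA intfc.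
  have e3 := RintegralD mA intA (intcst (- c)).
  apply: etrans (esym e1); rewrite e2 e3 !Rintegral_cst // -/(wt o) -wt_avg //.
  by rewrite -/c; ring.
apply: le_Rintegral => //.
- exact: mv.
- exact: (integrableD (mv o) (intcst _) intK).
- exact: (integrableS measurableT (mv o) (@subsetT _ _) intfp).
- by move=> x _; exact: powR_tangent.
Qed.

End FinitePartition.

(** * Coding real values by rational thresholds *)

Section Discretization.
Context {R : realType}.

(* All rationals are enumerated, with [0] as a harmless default. *)
Definition threshold (i : nat) : R := ratr (odflt 0 (unpickle i : option rat)).

Definition disc (m : nat) (x : R) : {ffun 'I_m -> bool} :=
  [ffun i : 'I_m => threshold i <= x].

(** Once a rational of (x - eps, x) and one of (x, x + eps) are among the thresholds, equal codes
    confine [y] between them. *)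
Lemma disc_sep x eps : 0 < eps -> exists m0, forall m y, (m0 <= m)%N ->
  disc m y = disc m x -> `|y - x| <= eps.
Proof.
move=> e0.
have [q1 q1x] := @rat_in_itvoo R (x - eps) x (ltac:(lra)).
have [q2 q2x] := @rat_in_itvoo R x (x + eps) (ltac:(lra)).
move: q1x q2x; rewrite !in_itv /= => /andP[l1 r1] /andP[l2 r2].
exists (maxn (pickle q1) (pickle q2)).+1 => m y; rewrite gtn_max => /andP[m1 m2] e.
have th q : threshold (pickle q) = ratr q by rewrite /threshold pickleK.
have := congr1 (fun f : {ffun 'I_m -> bool} => f (Ordinal m1)) e.
have := congr1 (fun f : {ffun 'I_m -> bool} => f (Ordinal m2)) e.
rewrite !ffunE /= !th (ltW r1) [ratr q2 <= x]leNgt l2 /= => y2 y1.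
have {}y2 : y < ratr q2 by rewrite ltNge y2.
by rewrite ler_norml; apply/andP; split; lra.
Qed.

Definition discs (I : finType) (m : nat) (S : Type) (f : I -> S -> R) (w : S) :
  {ffun I -> {ffun 'I_m -> bool}} := [ffun u => disc m (f u w)].

(** The measurable space is arbitrary because the lemma serves twice: on [T], and on [T] with the
    past sigma-algebra, where measurability is asked only of the functions indexed by [U]. *)
Lemma measurable_agree (I : finType) (m : nat) (d : measure_display)
    (S : measurableType d) (f : I -> S -> R) (U : {set I}) o :
  (forall u, u \in U -> measurable_fun setT (f u)) ->
  measurable [set w | agree U o (discs m f w)].
Proof.
move=> mf.
have -> : [set w | agree U o (discs m f w)] =
    \bigcap_(u in [set u | u \in U]) \bigcap_(i in @setT 'I_m)
      (f u @^-1` [set x | (threshold i <= x) = o u i]).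
  apply/seteqP; split => [w /= /agreeP h u uU i _ /=|w h].
    by rewrite (h u uU) !ffunE.
  apply/agreeP => u uU; apply/ffunP => i; rewrite !ffunE.
  exact/esym/(h u uU i).
apply: fin_bigcap_measurable; first exact: finite_finset.
move=> u uU; apply: fin_bigcap_measurable; first exact: finite_finset.
move=> i _; rewrite -[X in measurable X]setTI; apply: (mf _ uU) => //.
have [b|b] := boolP (o u i).
  rewrite (_ : [set x | _] = `[threshold i, +oo[%classic) //.
  by apply/seteqP; split => x; rewrite /= in_itv /= andbT.
rewrite (_ : [set x | _] = `]-oo, threshold i[%classic) //.
apply/seteqP; split => x; rewrite /= in_itv /= ltNge; first by move=> ->.
exact: negbTE.
Qed.

End Discretization.

Section FieldDiscretization.
Context {R : realType} {disp : measure_display} {T : measurableType disp}.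
Variables (P : probability T R) (d n : nat) (X : 'rV[int]_d -> {RV P >-> R}).
Hypothesis intX : integrable_field X.
Notation point := {ffun 'I_d -> 'I_n}.

Definition vec (t : point) : 'rV[int]_d := \row_i (t i).+1%:Z.

Definition cube_field (t : point) (w : T) : R := X (vec t) w.

Definition cfield (t : point) (w : T) : R := cube_field t w - mean P (X (vec t)).

Definition state (m : nat) : T -> {ffun point -> {ffun 'I_m -> bool}} :=
  discs m cube_field.

Lemma measurable_cube_field t : measurable_fun setT (cube_field t).
Proof. exact: measurable_funPT. Qed.

Lemma measurable_state_agree m U o :
  measurable (part (state m) (agree U o)).
Proof. by apply: measurable_agree => u _; exact: measurable_cube_field. Qed.

Lemma measurable_state m o : measurable (state m @^-1` [set o]).
Proof.
have -> : state m @^-1` [set o] = part (state m) (agree finset.setT o).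
  apply/seteqP; split => w /= => [<-|/agreeP h]; first exact: agree_refl.
  by apply/ffunP => u; rewrite h ?finset.in_setT.
exact: measurable_state_agree.
Qed.

Lemma integrable_cfield t : P.-integrable setT (EFin \o cfield t).
Proof.
have hc : P.-integrable setT (EFin \o cst (mean P (X (vec t)))).
  exact: finite_measure_integrable_cst.
exact: (integrableB measurableT (intX (vec t)) hc).
Qed.

Lemma past_agree m (t : point) r (U : {set point}) o :
  (forall u, u \in U -> exists i, (u i + r <= t i)%N) ->
  past_sigma X (vec t) r (part (state m) (agree U o)).
Proof.
move=> Ur; rewrite /past_sigma; set G := \bigcup_(u in _) _.
apply: (@measurable_agree R point m _ (g_sigma_algebraType G) cube_field U o) => u uU.
move=> _ Y mY; rewrite setTI; apply: sub_sigma_algebra.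
exists (vec u) => /=; last by exists Y => //; rewrite setTI.
have [i ui] := Ur u uU; exists i; rewrite !mxE.
by rewrite lerBrDr -PoszD lez_nat addnS ltnS addnC.
Qed.

(** Turns WD into a statement on finite sums: cylinders over [U] belong to [past_sigma], where X_t
    and its conditional expectation have equal integrals, hence equal averages. Jensen's inequality
    then carries the norm bound over to these averages. *)
Lemma cexp_version p M phi m (t : point) r (U : {set point}) : WD X p M phi ->
  (forall u, u \in U -> exists i, (u i + r <= t i)%N) ->
  exists Y : T -> R, [/\ P.-integrable setT (EFin \o Y),
    ('N[P]_p[EFin \o Y] <= (M * phi r)%:E)%E &
    forall o, cexp (wt P (state m)) U (avg P (state m) (cfield t)) o =
              cexp (wt P (state m)) U (avg P (state m) Y) o].
Proof.
move=> [_ _ /(_ (vec t) r)[Y [[mY intY eY] nY]]] Ur.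
have mst := @measurable_state m.
have intYm : P.-integrable setT (EFin \o (fun w => Y w - mean P (X (vec t)))).
  have hc : P.-integrable setT (EFin \o cst (mean P (X (vec t)))).
    exact: finite_measure_integrable_cst.
  exact: (integrableB measurableT intY hc).
exists (fun w => Y w - mean P (X (vec t))); split=> // o.
rewrite /cexp; congr (_ / _).
rewrite !(sum_wt_avg mst) //; last exact: integrable_cfield.
set A := part _ _.
have mA : measurable A by exact: measurable_state_agree.
have int_cst : P.-integrable A (EFin \o cst (mean P (X (vec t)))).
  exact: finite_measure_integrable_cst.
have intXA : P.-integrable A (EFin \o cube_field t).
  exact: (integrableS measurableT mA (@subsetT _ _) (intX _)).
have intYA : P.-integrable A (EFin \o Y).
  exact: (integrableS measurableT mA (@subsetT _ _) intY).
have e1 := RintegralB mA intXA int_cst.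
have e2 := RintegralB mA intYA int_cst.
apply: etrans e1 _; apply: etrans _ (esym e2); congr (_ - _).
by rewrite /Rintegral eY //; exact: past_agree.
Qed.

End FieldDiscretization.

(** * Weak dependence of the discretized field and passage to the limit *)

Section WeakDependence.
Context {R : realType} {disp : measure_display} {T : measurableType disp}.
Variables (P : probability T R) (d n : nat) (X : 'rV[int]_d -> {RV P >-> R}).
Hypothesis intX : integrable_field X.
Notation point := {ffun 'I_d -> 'I_n}.
Notation Z := (cfield X).

Lemma WD_bound_ge0 p M phi r : WD X p M phi -> 0 <= M * phi r.
Proof.
move=> [_ _ /(_ 0 r)[Y [_ nY]]].
by rewrite -lee_fin; apply: le_trans nY; exact: Lnorm_ge0.
Qed.

Lemma WD_constant_ge0 p M phi : WD X p M phi -> 0 <= M.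
Proof. by move=> wd; have := WD_bound_ge0 0 wd; case: wd => _ -> _; rewrite mulr1. Qed.

Lemma cexp_Lp_le (p M : R) phi m (t : point) r (U : {set point}) : 2 <= p ->
  WD X p%:E M phi ->
  (forall u, u \in U -> exists i, (u i + r <= t i)%N) ->
  Lp_le (wt P (state n X m)) p (cexp (wt P (state n X m)) U (avg P (state n X m) (Z t)))
    (M * phi r).
Proof.
move=> p2 wd Ur; have a0 := WD_bound_ge0 r wd.
have [Y [intY nY eY]] := cexp_version intX m wd Ur.
rewrite (funext eY); apply: Lp_le_cexp; [exact: wt_ge0|lra|].
apply: Lp_le_avg => //; [exact: measurable_state|lra|].
have p0 : p != 0 by rewrite gt_eqF //; lra.
have := powR_Lnorm P (EFin \o Y) p0.
move=> /= <-; rewrite -poweR_EFin; apply: gt0_ler_poweR => //; first lra.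
  by rewrite in_itv /= leey andbT Lnorm_ge0.
by rewrite in_itv /= leey andbT lee_fin.
Qed.

Lemma cexp_wsup_le (M : R) phi m (t : point) r (U : {set point}) :
  WD X +oo%E M phi ->
  (forall u, u \in U -> exists i, (u i + r <= t i)%N) ->
  wsup_le (wt P (state n X m)) (cexp (wt P (state n X m)) U (avg P (state n X m) (Z t)))
    (M * phi r).
Proof.
move=> wd Ur; have a0 := WD_bound_ge0 r wd.
have [Y [intY nY eY]] := cexp_version intX m wd Ur.
rewrite (funext eY); apply: wsup_le_cexp; first exact: wt_ge0.
apply: wsup_le_avg => //; first exact: measurable_state.
move: nY; rewrite Lnorm.unlock /= probability_setT lte01 => /ess_supP.
by apply: filterS => x; rewrite /= lee_fin.
Qed.

Lemma cfield_mean0 (t : point) : \int[P]_x Z t x = 0 :> R.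
Proof.
have hc : P.-integrable setT (EFin \o cst (mean P (X (vec t)))).
  exact: finite_measure_integrable_cst.
apply: etrans (RintegralB measurableT (intX (vec t)) hc) _.
have -> : \int[P]_(x in setT) cst (mean P (X (vec t))) x = mean P (X (vec t)).
  by rewrite Rintegral_cst //= probability_setT mulr1.
by rewrite /mean unlock subrr.
Qed.

(** Outside this null set the cell of the current state has positive measure, so the quotient in
    [cexp] is a genuine average. *)
Definition null_states (m : nat) : set T :=
  part (state n X m) (fun o => wt P (state n X m) o == 0).

Definition null_union : set T := \bigcup_m null_states m.

Lemma null_statesP m : measurable (null_states m) /\ P (null_states m) = 0%E.
Proof.
have mN : measurable (null_states m) by apply: measurable_part; exact: measurable_state.
split=> //; have := sum_wt P (@measurable_state _ _ _ P d n X m)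
  (fun o => wt P (state n X m) o == 0).
rewrite big1 => [|o /eqP //] e.
by rewrite -[LHS]fineK ?fin_num_measure // -e.
Qed.

Lemma null_unionP : measurable null_union /\ P null_union = 0%E.
Proof.
have mN : measurable null_union by apply: bigcup_measurable => m _; exact: (null_statesP m).1.
split=> //; apply/negligibleP => //; apply: negligible_bigcup => m.
by apply/negligibleP; [exact: (null_statesP m).1|exact: (null_statesP m).2].
Qed.

(** No martingale convergence is involved: as [t] belongs to [U], X_t varies by at most [eps] on the
    cell of [w], so its average there is within [eps] of its value at [w]. *)
Lemma cexp_cvg (t : point) (U : {set point}) w : t \in U -> ~ null_union w ->
  cexp (wt P (state n X m)) U (avg P (state n X m) (Z t)) (state n X m w) @[m --> \oo]
    --> Z t w.
Proof.
move=> tU Nw; apply/cvgrPdist_le => eps e0.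
have [m0 hm0] := disc_sep (cube_field X t w) e0.
near=> m.
have mm0 : (m0 <= m)%N by near: m; exact: nbhs_infty_ge.
set v := state n X m.
have mv o : measurable (v @^-1` [set o]) by exact: measurable_state.
rewrite /cexp (sum_wt_avg mv) ?(sum_wt P mv); last exact: integrable_cfield.
set A := part v (agree U (v w)).
have mA : measurable A by exact: measurable_part.
have PA : 0 < fine (P A).
  rewrite -(sum_wt P mv) (bigD1 (v w)) ?agree_refl //= ltr_pwDl ?sumr_ge0 //.
    rewrite lt_neqAle wt_ge0 andbT eq_sym; apply/negP => vw0; apply: Nw.
    by exists m.
  by move=> o _; exact: wt_ge0.
have intA : P.-integrable A (EFin \o Z t).
  exact: (integrableS measurableT mA (@subsetT _ _) (integrable_cfield intX t)).
have intc c : P.-integrable A (EFin \o cst c).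
  exact: finite_measure_integrable_cst.
have bnd w' : A w' -> `|Z t w' - Z t w| <= eps.
  move=> /agreeP/(_ t tU); rewrite /v !ffunE => e.
  have -> : Z t w' - Z t w = cube_field X t w' - cube_field X t w by rewrite /cfield; ring.
  exact: hm0 mm0 (esym e).
rewrite ler_norml lerBlDr lerNl opprB lerBlDl.
have e1 : \int[P]_(x in A) Z t x <= (Z t w + eps) * fine (P A).
  rewrite -(Rintegral_cst P mA); apply: (le_Rintegral mA intA (intc (Z t w + eps))) => x Ax.
  by have := bnd x Ax; rewrite ler_norml /= => /andP[]; lra.
have e2 : (Z t w - eps) * fine (P A) <= \int[P]_(x in A) Z t x.
  rewrite -(Rintegral_cst P mA); apply: (le_Rintegral mA (intc (Z t w - eps)) intA) => x Ax.
  by have := bnd x Ax; rewrite ler_norml /= => /andP[]; lra.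
rewrite -ler_pdivrMr // in e1; rewrite -ler_pdivlMr // in e2.
by apply/andP; split; lra.
Unshelve. all: by end_near. Qed.

(** Applied with [Phi] equal to |x|^p or to exp (l x). *)
Lemma limit_bound (Phi : R -> R) (B : R)
    (F : forall m, {ffun point -> {ffun 'I_m -> bool}} -> R) (S : T -> R) :
  (forall x, 0 <= Phi x) -> measurable_fun setT Phi -> measurable_fun setT S ->
  (forall (u : nat -> R) l, u m @[m --> \oo] --> l -> Phi (u m) @[m --> \oo] --> Phi l) ->
  (forall m, wmean (wt P (state n X m)) (fun o => Phi (F m o)) <= B) ->
  (forall w, ~ null_union w -> F m (state n X m w) @[m --> \oo] --> S w) ->
  (\int[P]_w (Phi (S w))%:E <= B%:E)%E.
Proof.
move=> Phi0 mPhi mS cPhi FB FS.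
have [mN PN] := null_unionP.
rewrite (ge0_negligible_integral mN measurableT _ _ PN); last 2 first.
- by apply/measurable_EFinP; exact: measurableT_comp.
- by move=> w _; rewrite lee_fin.
have mD : measurable (setT `\` null_union) by exact: measurableD.
pose f m w := (Phi (F m (state n X m w)))%:E.
have mf m : measurable_fun setT (f m).
  apply/measurable_EFinP.
  exact: (measurable_fun_atoms (@measurable_state _ _ _ P d n X m) (fun o => Phi (F m o))).
rewrite (eq_integral (fun w => limn_einf (f ^~ w))); last first.
  move=> w; rewrite inE => -[_ Nw].
  have h : f m w @[m --> \oo] --> (Phi (S w))%:E.
    by apply/cvg_EFin; [exact: nearW|exact: cPhi (FS w Nw)].
  by rewrite (cvg_limn_einf_sup h).1.
apply: le_trans (fatou P mD (fun m => measurable_funTS (mf m)) _) _.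
  by move=> m w _; rewrite lee_fin.
have fB m : (\int[P]_(w in setT `\` null_union) f m w <= B%:E)%E.
  apply: (@le_trans _ _ (\int[P]_w f m w)%E).
    apply: ge0_subset_integral => //.
    by move=> w _; rewrite lee_fin.
  have := ge0_integral_part P (@measurable_state _ _ _ P d n X m) predT
    (fun o => Phi0 (F m o)).
  by rewrite partT /f => ->; rewrite lee_fin; exact: FB.
rewrite limn_einf_lim; apply: lime_le; first exact: is_cvg_einfs.
apply: nearW => m; apply: le_trans (fB m); apply: ereal_inf_lbound.
by exists m => /=.
Qed.

End WeakDependence.

Lemma cvg_norm_powR (R : realType) (p : R) (u : nat -> R) (l : R) : 1 <= p ->
  u m @[m --> \oo] --> l -> `|u m| `^ p @[m --> \oo] --> `|l| `^ p.
Proof.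
move=> p1 /cvg_norm; move: (normr_ge0 l); rewrite le_eqVlt => /predU1P[<-|l0] ul.
  (* The limit 0 is treated apart, as differentiability of the power is used only at positive
     points: |u|^p <= |u| once |u| <= 1. *)
  rewrite powR0; last by rewrite gt_eqF //; lra.
  apply/cvgrPdist_le => eps e0; near=> m.
  have : `|u m| <= Num.min eps 1.
    rewrite -[leLHS]normr_id; near: m; apply: (cvgr_norm_le _ ul).
    by rewrite normr0 lt_min e0 ltr01.
  rewrite le_min => /andP[ue u1]; rewrite sub0r normrN ger0_norm ?powR_ge0 //.
  apply: le_trans ue; have [->|un0] := eqVneq `|u m| 0.
    by rewrite powR0 // gt_eqF //; lra.
  by apply: ge1r_powR => //; rewrite u1 lt_neqAle eq_sym un0 normr_ge0.
have cp : {for `|l|, continuous (fun y : R => y `^ p)}.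
  apply: differentiable_continuous; apply/derivable1_diffP.
  by have [] := is_derive1_powR p l0.
exact: (@continuous_cvg _ _ _ _ _ _ (fun y : R => y `^ p) _ cp ul).
Unshelve. all: by end_near. Qed.

(** * Bounds on the cube average *)

Section MainBound.
Context {R : realType} {disp : measure_display} {T : measurableType disp}.
Variables (P : probability T R) (d n k : nat) (h : nat -> nat).
Variables (X : 'rV[int]_d -> {RV P >-> R}) (M : R) (phi : nat -> R).
Hypothesis intX : integrable_field X.
Hypothesis d_gt0 : (0 < d)%N.
Hypothesis n_le : (n <= 2 ^ k.+1)%N.
Hypothesis phi_decr : forall r s : nat, (r <= s)%N -> phi s <= phi r.
Hypothesis M_ge0 : 0 <= M.
Hypothesis Mphi_ge0 : forall r, 0 <= M * phi r.
Notation point := {ffun 'I_d -> 'I_n}.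
Notation Z := (cfield X).
Notation sel s := (selected h k n (fun i => s i : nat)).

Let c : R := ((n ^ d)%:R * ((2 ^ k) ^ d)%:R)^-1.

(** [c] divides by the number of points and by the number of shifts selecting each of them. As
    [shift_past s t] contains [t], every term tends to [Z t] when thresholds are added. *)
Definition cexp_average (m : nat) (o : {ffun point -> {ffun 'I_m -> bool}}) : R :=
  c * \sum_(s : {ffun 'I_d -> 'I_(period h k)}) \sum_(t in sel s)
    cexp (wt P (state n X m)) (shift_past s t) (avg P (state n X m) (Z t)) o.

Lemma cexp_average_cvg w : ~ null_union n X w ->
  cexp_average (state n X m w) @[m --> \oo] --> cube_average X n w.
Proof.
move=> Nw.
have -> : cube_average X n w =
    c * \sum_(s : {ffun 'I_d -> 'I_(period h k)}) \sum_(t in sel s) Z t w.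
  under eq_bigr do rewrite big_mkcond.
  rewrite exchange_big /=.
  have -> : \sum_(t : point) \sum_(s : {ffun 'I_d -> 'I_(period h k)})
      (if t \in sel s then Z t w else 0) = ((2 ^ k) ^ d)%:R * \sum_(t : point) Z t w.
    rewrite mulr_sumr; apply: eq_bigr => t _.
    rewrite -(selected_count h k t) natr_sum mulr_suml; apply: eq_bigr => s _.
    by case: ifP; rewrite ?mul1r ?mul0r.
  rewrite /c invfM mulrA -[_ * _ * ((2 ^ k) ^ d)%:R]mulrA mulVf ?mulr1 //.
apply: cvgM; first exact: cvg_cst.
apply: (cvg_big add_continuous) => s _.
apply: (cvg_big add_continuous) => t ts.
apply: cexp_cvg => //.
by rewrite /shift_past inE ts leqnn.
Qed.

Variables (kap : R).
Variables (nI nO : forall m, ({ffun point -> {ffun 'I_m -> bool}} -> R) -> R -> Prop).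
Hypothesis kap_ge0 : 0 <= kap.
Hypothesis norms : forall m, chaining_norms (wt P (state n X m)) kap (@nI m) (@nO m).
Hypothesis cexp_nI : forall m (t : point) r (U : {set point}),
  (forall u, u \in U -> exists i, (u i + r <= t i)%N) ->
  nI (cexp (wt P (state n X m)) U (avg P (state n X m) (Z t))) (M * phi r).

Lemma gap_le j : (gap h j <= gap h j.+1)%N.
Proof.
case: j => [//|j]; rewrite /gap ltnS [leqRHS]big_ord_recr; exact: leq_addr.
Qed.

Lemma cexp_average_bound m : nO (@cexp_average m)
  (c * ((period h k ^ d)%:R * level_sum d n k kap (fun j => M * phi (gap h j)))).
Proof.
have mst := @measurable_state _ _ _ P d n X m.
apply: (averaged_bound d_gt0 n_le (wt_ge0 P _) (wt_sum1 P mst) kap_ge0 (norms m)).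
- move=> t; rewrite /wmean (sum_wt_avg mst predT (integrable_cfield intX t)) partT.
  exact: cfield_mean0.
- by move=> j t U; exact: cexp_nI.
- by move=> j; exact: Mphi_ge0.
- by move=> j; apply: ler_wpM2l => //; apply: phi_decr; exact: gap_le.
- by rewrite invr_ge0 mulr_ge0 ?ler0n.
Qed.

End MainBound.

Section CubeAverage.
Context {R : realType} {disp : measure_display} {T : measurableType disp}.
Variables (P : probability T R) (d n k : nat) (h : nat -> nat).
Variables (X : 'rV[int]_d -> {RV P >-> R}) (M : R) (phi : nat -> R).
Hypothesis intX : integrable_field X.
Hypothesis d_gt0 : (0 < d)%N.
Hypothesis n_le : (n <= 2 ^ k.+1)%N.

Let bound (kap : R) : R := ((n ^ d)%:R * ((2 ^ k) ^ d)%:R)^-1 *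
  ((period h k ^ d)%:R * level_sum d n k kap (fun j => M * phi (gap h j))).

Lemma measurable_cube_average : measurable_fun setT (cube_average X n).
Proof.
apply: measurable_funM => //; apply: measurable_sum => t.
by apply: measurable_funB => //; exact: measurable_cube_field.
Qed.

Lemma Lnorm_cube_average p : 2 <= p -> WD X p%:E M phi ->
  ('N[P]_(p%:E) [EFin \o cube_average X n] <= (bound p)%:E)%E.
Proof.
move=> p2 wd; have p0 : 0 < p by lra.
have p1 : 1 <= p by lra.
have [decr _ _] := wd.
have norms m := Lp_chaining_norms (wt_ge0 P (state n X m))
  (wt_sum1 P (@measurable_state _ _ _ P d n X m)) p2.
have F := cexp_average_bound h intX d_gt0 n_le decr (WD_constant_ge0 wd)
  (fun r => WD_bound_ge0 r wd) (ltW p0) norms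
  (fun m t r U => cexp_Lp_le intX m (t := t) p2 wd (U := U)).
have b0 : 0 <= bound p by have [] := F 0%N.
have : (\int[P]_w (`|cube_average X n w| `^ p)%:E <= (bound p `^ p)%:E)%E.
  refine (@limit_bound R disp T P d n X (fun x => `|x| `^ p) (bound p `^ p)
    (fun m => @cexp_average R disp T P d n k h X m) (cube_average X n) _ _ _ _ _ _).
  - by move=> x; exact: powR_ge0.
  - by apply: (measurableT_comp (measurable_powR p)); exact: normr_measurable.
  - exact: measurable_cube_average.
  - by move=> u l; exact: cvg_norm_powR.
  - by move=> m; have [] := F m.
  - by move=> w; exact: cexp_average_cvg.
move=> le_int; rewrite Lnorm.unlock /=.
have -> : (bound p)%:E = ((bound p `^ p)%:E `^ p^-1)%E.
  by rewrite poweR_EFin -powRrM divff ?gt_eqF // powRr1.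
apply: gt0_ler_poweR => //.
- by rewrite invr_ge0 ltW.
- by rewrite in_itv /= leey andbT; apply: integral_ge0 => w _; rewrite lee_fin powR_ge0.
- by rewrite in_itv /= leey andbT lee_fin powR_ge0.
Qed.

Lemma sub_gaussian_cube_average : WD X +oo%E M phi ->
  (sub_gaussian_norm P (cube_average X n) <= (bound 1)%:E)%E.
Proof.
move=> wd; have [decr _ _] := wd.
have norms m := sub_gauss_chaining_norms (wt_ge0 P (state n X m))
  (wt_sum1 P (@measurable_state _ _ _ P d n X m)).
have F := cexp_average_bound h intX d_gt0 n_le decr (WD_constant_ge0 wd)
  (fun r => WD_bound_ge0 r wd) ler01 norms
  (fun m t r U => cexp_wsup_le intX m (t := t) wd (U := U)).
apply: ereal_inf_lbound; exists (bound 1) => //; split; first by have [] := F 0%N.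
move=> l; rewrite unlock.
refine (@limit_bound R disp T P d n X (fun x => expR (l * x)) _
    (fun m => @cexp_average R disp T P d n k h X m) (cube_average X n) _ _ _ _ _ _).
- by move=> x; exact: expR_ge0.
- apply: (@measurableT_comp _ _ _ _ _ _ (@expR R) _ (fun x : R => l * x)); [exact: measurable_expR|exact: measurable_funM].
- exact: measurable_cube_average.
- move=> u y uy; apply: continuous_cvg; first exact: continuous_expR.
  by apply: cvgM => //; exact: cvg_cst.
- by move=> m; have [_] := F m; exact.
- by move=> w; exact: cexp_average_cvg.
Qed.

End CubeAverage.

(** exp y dominates y^q / q! for an integer q > d/eta. Having [C >= 1] keeps the product with [c] an
    admissible constant. *)
Lemma expR_le_powR (R : realType) (d : nat) (gamma eta : R) : 0 < gamma -> 0 < eta ->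
  exists2 C : R, 1 <= C &
    forall r : nat, (0 < r)%N -> expR (- gamma * r%:R `^ eta) <= C * r%:R `^ (- d%:R).
Proof.
move=> g0 e0; pose m := Num.truncn (d%:R / eta).
pose C0 : R := (m.+1)`!%:R / gamma ^+ m.+1.
have C00 : 0 <= C0 by rewrite divr_ge0 // exprn_ge0 // ltW.
exists (1 + C0) => [|r r0]; first by lra.
have r1 : 1 <= r%:R :> R by rewrite ler1n.
have y0 : 0 <= gamma * r%:R `^ eta by rewrite mulr_ge0 ?powR_ge0 // ltW.
rewrite mulNr expRN powRN ler_pdivlMr ?powR_gt0 ?ltr0n // mulrC.
rewrite ler_pdivrMr ?expR_gt0 //.
have pw : r%:R `^ d%:R <= (r%:R `^ eta) ^+ m.+1.
  rewrite -powR_mulrn ?powR_ge0 // -powRrM; apply: ler_powR => //.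
  have := truncnS_gt (d%:R / eta); rewrite -/m ltr_pdivrMr // mulrC => h.
  exact: ltW.
apply: (le_trans pw).
have ex : (gamma * r%:R `^ eta) ^+ m.+1 / (m.+1)`!%:R <= expR (gamma * r%:R `^ eta).
  by apply: le_trans (expR_ge1Dxn m y0); rewrite lerDr.
have -> : (r%:R `^ eta) ^+ m.+1 =
    C0 * ((gamma * r%:R `^ eta) ^+ m.+1 / (m.+1)`!%:R).
  rewrite /C0 exprMn; field.
  by rewrite pnatr_eq0 -lt0n fact_gt0 /= expf_neq0 // gt_eqF.
apply: (@le_trans _ _ (C0 * expR (gamma * r%:R `^ eta))); first exact: ler_wpM2l.
by rewrite ler_wpM2r ?expR_ge0 //; lra.
Qed.

Lemma C_poly_ge0 (R : realType) (d : nat) (alpha : R) : 0 <= C_poly d alpha.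
Proof. by rewrite /C_poly !mulr_ge0 ?powR_ge0. Qed.

Lemma C_crit_ge0 (R : realType) (d : nat) : 0 <= C_crit d :> R.
Proof. by rewrite /C_crit mulr_ge0 ?powR_ge0. Qed.

Lemma cube_average_rates (R : realType) (d : nat) (disp : measure_display)
    (T : measurableType disp) (P : probability T R) (X : 'rV[int]_d -> {RV P >-> R})
    (n : nat) (M : R) (phi : nat -> R) (c alpha : R) : (0 < d)%N ->
  (2 <= n)%N -> integrable_field X -> 1 <= c -> 0 < alpha ->
  (forall r : nat, (0 < r)%N -> phi r <= c * r%:R `^ (- alpha)) ->
  let N : R := (n ^ d)%N%:R in
  (forall p : R, 2 <= p -> WD X p%:E M phi ->
    (alpha <> d%:R / 2 ->
      ('N[P]_(p%:E) [EFin \o cube_average X n] <=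
        (c * C_poly d alpha * Num.sqrt p * M *
         N `^ (- Num.min (1 / 2) (alpha / d%:R)))%:E)%E) /\
    (alpha = d%:R / 2 ->
      ('N[P]_(p%:E) [EFin \o cube_average X n] <=
        (c * C_crit d * Num.sqrt p * M *
         N `^ (- (1 / 2)) * log2 N `^ (d%:R / 2 + 1))%:E)%E)) /\
  (WD X +oo%E M phi ->
    (alpha <> d%:R / 2 ->
      (sub_gaussian_norm P (cube_average X n) <=
        (5 / 2 * c * C_poly d alpha * M *
         N `^ (- Num.min (1 / 2) (alpha / d%:R)))%:E)%E) /\
    (alpha = d%:R / 2 ->
      (sub_gaussian_norm P (cube_average X n) <=
        (5 / 2 * c * C_crit d * M *
         N `^ (- (1 / 2)) * log2 N `^ (d%:R / 2 + 1))%:E)%E)).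
Proof.
move=> d_gt0 n2 intX c1 a0 phi_le N.
have main p : WD X p M phi -> exists k h, (n <= 2 ^ k.+1)%N /\
  forall kap : R, 0 <= kap ->
  let bound := (N * ((2 ^ k) ^ d)%:R)^-1 *
    ((period h k ^ d)%:R * level_sum d n k kap (fun j => M * phi (gap h j))) in
  (alpha <> d%:R / 2 -> bound <= c * C_poly d alpha * Num.sqrt kap * M *
     N `^ (- Num.min (1 / 2) (alpha / d%:R))) /\
  (alpha = d%:R / 2 -> bound <= c * C_crit d * Num.sqrt kap * M *
     N `^ (- (1 / 2)) * log2 N `^ (d%:R / 2 + 1)).
  move=> wd; have [_ phi0 _] := wd.
  have [k [h [nk kh]]] := rate_bounds d_gt0 n2 a0 c1 phi0 phi_le.
  exists k, h; split=> // kap kap0.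
  exact: kh kap0 (WD_constant_ge0 wd).
split=> [p p2 wd|wd]; have [k [h [nk kh]]] := main _ wd.
  have p0 : 0 <= p by lra.
  have [h1 h2] := kh p p0.
  have le_b := Lnorm_cube_average h intX d_gt0 nk p2 wd.
  by split=> e; apply: le_trans le_b _; rewrite lee_fin; [exact: h1|exact: h2].
have [h1 h2] := kh 1 ler01.
have le_b := sub_gaussian_cube_average h intX d_gt0 nk wd.
have M0 := WD_constant_ge0 wd.
split=> e; apply: le_trans le_b _; rewrite lee_fin.
  (* Azuma's step, with [kap] = 1, gives the constant 1, which is below 5/2. *)
  apply: le_trans (h1 e) _; rewrite sqrtr1 mulr1.
  rewrite -[5 / 2 * c * _]mulrA -[5 / 2 * _ * M]mulrA -[5 / 2 * _ * _]mulrA.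
  apply: ler_peMl; last by lra.
  by rewrite !mulr_ge0 ?powR_ge0 ?C_poly_ge0 // (le_trans _ c1).
apply: le_trans (h2 e) _; rewrite sqrtr1 mulr1.
rewrite -[5 / 2 * c * _]mulrA -[5 / 2 * _ * M]mulrA -[5 / 2 * _ * _]mulrA -[5 / 2 * _ * _]mulrA.
apply: ler_peMl; last by lra.
by rewrite !mulr_ge0 ?powR_ge0 ?C_crit_ge0 // (le_trans _ c1).
Qed.

Unset Implicit Arguments.

Theorem corollary2 (R : realType) (d : nat) (d_gt0 : (0 < d)%N) :
  (forall (disp : measure_display) (T : measurableType disp)
      (P : probability T R) (X : 'rV[int]_d -> {RV P >-> R})
      (n : nat) (M : R) (phi : nat -> R) (c alpha : R),
    (2 <= n)%N -> integrable_field X -> 1 <= c -> 0 < alpha ->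
    (forall r : nat, (0 < r)%N -> phi r <= c * r%:R `^ (- alpha)) ->
    let N : R := (n ^ d)%N%:R in
    (forall p : R, 2 <= p -> WD X p%:E M phi ->
      (alpha <> d%:R / 2 ->
        ('N[P]_(p%:E) [EFin \o cube_average X n] <=
          (c * C_poly d alpha * Num.sqrt p * M *
           N `^ (- Num.min (1 / 2) (alpha / d%:R)))%:E)%E) /\
      (alpha = d%:R / 2 ->
        ('N[P]_(p%:E) [EFin \o cube_average X n] <=
          (c * C_crit d * Num.sqrt p * M *
           N `^ (- (1 / 2)) * log2 N `^ (d%:R / 2 + 1))%:E)%E))
    /\
    (WD X +oo%E M phi ->
      (alpha <> d%:R / 2 ->
        (sub_gaussian_norm P (cube_average X n) <=
          (5 / 2 * c * C_poly d alpha * M *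
           N `^ (- Num.min (1 / 2) (alpha / d%:R)))%:E)%E) /\
      (alpha = d%:R / 2 ->
        (sub_gaussian_norm P (cube_average X n) <=
          (5 / 2 * c * C_crit d * M *
           N `^ (- (1 / 2)) * log2 N `^ (d%:R / 2 + 1))%:E)%E)))
  /\
  (forall gamma eta : R, 0 < gamma -> 0 < eta ->
    exists K : R, 0 < K /\
    forall (disp : measure_display) (T : measurableType disp)
      (P : probability T R) (X : 'rV[int]_d -> {RV P >-> R})
      (n : nat) (M : R) (phi : nat -> R) (c : R),
    (2 <= n)%N -> integrable_field X -> 1 <= c ->
    (forall r : nat, (0 < r)%N ->
      phi r <= c * expR (- gamma * r%:R `^ eta)) ->
    let N : R := (n ^ d)%N%:R in
    (forall p : R, 2 <= p -> WD X p%:E M phi ->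
      ('N[P]_(p%:E) [EFin \o cube_average X n] <=
        (c * M * (K * Num.sqrt p) * N `^ (- (1 / 2)))%:E)%E)
    /\
    (WD X +oo%E M phi ->
      (sub_gaussian_norm P (cube_average X n) <=
        (c * M * K * N `^ (- (1 / 2)))%:E)%E)).
Proof.
split.
  move=> disp T P X n M phi c alpha n2 intX c1 a0 phi_le.
  exact: cube_average_rates.
move=> gamma eta g0 e0.
have [C C1 expC] := expR_le_powR d g0 e0.
have d0 : 0 < d%:R :> R by rewrite ltr0n.
have Cp0 : 0 <= C_poly d d%:R :> R := C_poly_ge0 _ _.
have CCp0 : 0 <= C * C_poly d d%:R by rewrite mulr_ge0 // (le_trans _ C1).
(* The order alpha = d exceeds d/2, hence the rate N^(-1/2). The factor 5/2 serves the sub-Gaussian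
   bound, and the summand 1 makes the constant positive. *)
exists (5 / 2 * (C * C_poly d d%:R) + 1); split; first by lra.
move=> disp T P X n M phi c n2 intX c1 phi_le N.
have cC1 : 1 <= c * C by apply: mulr_ege1.
have phi_le' r : (0 < r)%N -> phi r <= c * C * r%:R `^ (- d%:R).
  move=> r0; apply: le_trans (phi_le r r0) _; rewrite -mulrA.
  by apply: ler_wpM2l; [exact: le_trans c1|exact: expC].
have dne : d%:R <> d%:R / 2 :> R by lra.
have minE : Num.min (1 / 2) (d%:R / d%:R) = 1 / 2 :> R.
  by rewrite divff ?gt_eqF //; apply: min_l; lra.
have [hp hy] := cube_average_rates M d_gt0 n2 intX cC1 d0 phi_le'.
have N0 : 0 <= N `^ (- (1 / 2)) := powR_ge0 _ _.
split=> [p p2 wd|wd]; have M0 := WD_constant_ge0 wd.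
  apply: le_trans ((hp p p2 wd).1 dne) _; rewrite lee_fin minE -/N.
  apply: ler_wpM2r => //.
  rewrite [X in X <= _](_ : _ = c * M * (C * C_poly d d%:R * Num.sqrt p)); last by ring.
  apply: ler_wpM2l; first by rewrite mulr_ge0 // (le_trans _ c1).
  by apply: ler_wpM2r; [exact: sqrtr_ge0|lra].
apply: le_trans ((hy wd).1 dne) _; rewrite lee_fin minE -/N.
apply: ler_wpM2r => //.
rewrite [X in X <= _](_ : _ = c * M * (5 / 2 * (C * C_poly d d%:R))); last by ring.
apply: ler_wpM2l; first by rewrite mulr_ge0 // (le_trans _ c1).
by lra.
Qed.
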